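(* Let $L>0$ be fixed and let $T\subset\mathbb{R}^2$ be the closed triangle with vertices $(0,0)$, $(L,0)$, $(0,L)$. For $m\ge2$ and $(\ell_1,\ell_2)\in T$ let $\mathcal{P}[\ell_1,m,\ell_2]$ be the pumpkin-on-a-stick of total length $L$, with terminal vertices $v_-,v_+$, and write $\ell=\ell_1+\ell_2$. Then $\lambda_2^N(\mathcal{P}[\ell_1,m,\ell_2])$ is simple with corresponding eigenfunction monotonic from $v_-$ to $v_+$, unless the graph is a pumpkin. For each fixed $m\ge2$ the function $(\ell_1,\ell_2)\mapsto\lambda_2^N(\mathcal{P}[\ell_1,m,\ell_2])$ is continuous on the closed triangle $T$. Moreover: (1) for fixed $m\ge2$ we have $\lambda_2^N(\mathcal{P}[\ell_1,m,\ell_2])>\lambda_2^N(\mathcal{P}[\ell_1',m,\ell_2'])$ whenever $\ell_1\le\ell_1'$ and $\ell_2\le\ell_2'$ with at least one inequality strict (where $(\ell_1,\ell_2),(\ell_1',\ell_2')\in T$); (2) for fixed $(\ell_1,\ell_2)\in T$ the function $m\mapsto\lambda_2^N(\mathcal{P}[\ell_1,m,\ell_2])$ is strictly monotonically increasing in $m\ge2$; (3) for fixed $m\ge2$ and fixed $\ell=\ell_1+\ell_2$, the function $\ell_1\mapsto\lambda_2^N(\mathcal{P}[\ell_1,m,\ell-\ell_1])$ is strictly monotonically increasing in $\ell_1\in[0,\ell/2]$; (4) in particular, among all pumpkin-on-a-stick graphs (of total length $L$, with $m\ge2$) with fixed $\ell$ and $m$, the minimum of $\lambda_2^N$ is achieved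 at $\ell_1=0$, and among all pumpkin-on-a-stick graphs with fixed $\ell$, the minimum is achieved at $\ell_1=0$ and $m=2$, i.e. at the tadpole whose tail has length $\ell$. Finally, for given $m\ge2$, $$\frac{\pi^2}{L^2}\le\lambda_2^N(\mathcal{P}[\ell_1,m,\ell_2])\le\frac{\pi^2m^2}{L^2},$$ with equality in the lower estimate if and only if $\mathcal{P}[\ell_1,m,\ell_2]$ is a path (i.e. $\ell=L$) and in the upper one if and only if $\mathcal{P}[\ell_1,m,\ell_2]$ is a pumpkin (i.e. $\ell=0$).
   Context: Metric graphs have finitely many edges, each identified with a compact interval, with natural conditions at all vertices: functions are continuous at each vertex and the sum of the outward derivatives over all edges at the vertex is zero. For a connected graph, $0=\lambda_1^N<\lambda_2^N\le\lambda_3^N\le\dots$ are the eigenvalues (with multiplicity) of the Laplacian $-d^2/dx^2$ with these conditions. The pumpkin-on-a-stick $\mathcal{P}[\ell_1,m,\ell_2]$ of total length $L$ has vertices $v_-,v_1,v_2,v_+$ in this order: one edge of length $\ell_1$ between $v_-$ and $v_1$, $m$ parallel edges each of length $(L-\ell_1-\ell_2)/m$ between $v_1$ and $v_2$, and one edge of length $\ell_2$ between $v_2$ and $v_+$; edges of length $0$ are contracted to a point. An (equilateral $m$-)pumpkin consists of two vertices and $m$ parallel edges of equal length between them. A path consists of a single edge with two distinct end vertices. A tadpole is a loop attached to one end of an edge (the tail). A function on $\mathcal{P}[\ell_1,m,\ell_2]$ is monotonic from $v_-$ to $v_+$ if it is monotonically increasing, or monotonically decreasing, along every edge in the direction from $v_-$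 to $v_+$.
   Formalization: In (2) and (3) strict monotonicity is asserted only for ℓ<L: when ℓ=L the graph is the path of length L for all m and ℓ₁, so λ₂ is constantly π²/L² and the strict claims fail there. *)

(* Defs.v *)
From HB Require Import structures.
From mathcomp Require Import all_boot all_order all_algebra.
From mathcomp Require Import all_classical all_reals all_analysis.

Set Implicit Arguments.
Unset Strict Implicit.
Unset Printing Implicit Defensive.

Import Order.TTheory GRing.Theory Num.Theory.
Import numFieldNormedType.Exports.

Local Open Scope classical_set_scope.
Local Open Scope ring_scope.

(* The edge e is identified with the interval [0, len e], the coordinate
   running from src e to tgt e.  Loops and parallel edges are allowed. *)
Record metric_graph (R : realType) := MetricGraph {
  vertex : finType;
  edge : finType;
  src : edge -> vertex;
  tgt : edge -> vertex;
  len : edge -> R;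
  len_gt0 : forall e, 0 < len e }.

Section Laplacian.
Context {R : realType} (G : metric_graph R).

(* Only the values of f e on [0, len e] are meaningful. *)
Definition graph_fun := edge G -> R -> R.

Definition on_edge (e : edge G) : interval R := `[0, len e]%R.

Definition continuous_at_vertices (f : graph_fun) :=
  exists phi : vertex G -> R,
    forall e, f e 0 = phi (src e) /\ f e (len e) = phi (tgt e).

(* The sum of the derivatives in the direction pointing away from the vertex;
   a loop contributes at both of its ends. *)
Definition kirchhoff (f : graph_fun) :=
  forall v : vertex G,
    \sum_(e : edge G | src e == v) derive1 (f e) 0
    - \sum_(e : edge G | tgt e == v) derive1 (f e) (len e) = 0.

(* The derivatives are two-sided also at the ends of [0, len e]: since every
   C^2 function on a compact interval extends to a C^2 function on R, this only
   fixes how a function on the edge is represented, not which functions on the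
   edge occur. *)
Definition solves_on_edges (mu : R) (f : graph_fun) :=
  forall e x, x \in on_edge e ->
    [/\ derivable (f e) x 1, derivable (derive1 (f e)) x 1
      & - derive1 (derive1 (f e)) x = mu * f e x].

(* Contains the zero function. *)
Definition laplacian_eigenspace (mu : R) (f : graph_fun) :=
  [/\ solves_on_edges mu f, continuous_at_vertices f & kirchhoff f].

Definition linearly_independent (n : nat) (f : 'I_n -> graph_fun) :=
  forall c : 'I_n -> R,
    (forall e x, x \in on_edge e -> \sum_(i < n) c i * f i e x = 0) ->
    forall i, c i = 0.

(* The number of eigenvalues lying in A, counted with multiplicity, is at
   least n.  (Eigenspaces of distinct eigenvalues are independent, so the
   largest such n is the sum of the multiplicities.) *)
Definition count_ge (A : set R) (n : nat) :=
  exists (mu : 'I_n -> R) (f : 'I_n -> graph_fun),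
    (forall i, A (mu i) /\ laplacian_eigenspace (mu i) (f i)) /\ linearly_independent f.

Definition simple_eigenvalue (mu : R) :=
  count_ge [set mu] 1 /\ ~ count_ge [set mu] 2.

Definition is_kth_eigenvalue (k : nat) (mu : R) :=
  count_ge [set x | x <= mu] k /\ ~ count_ge [set x | x < mu] k.

Lemma is_kth_eigenvalue_inj k mu nu :
  is_kth_eigenvalue k mu -> is_kth_eigenvalue k nu -> mu = nu.
Proof.
have aux a b : a < b -> count_ge [set x | x <= a] k ->
    count_ge [set x | x < b] k.
  move=> ab [m [f [mf fli]]]; exists m, f; split=> // i.
  by have [mi fi] := mf i; split=> //; exact: le_lt_trans mi ab.
move=> [mu1 mu2] [nu1 nu2]; case: (ltgtP mu nu) => // h.
- by case: nu2; exact: aux mu1.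
- by case: mu2; exact: aux nu1.
Qed.

(* Numbered from k = 1.  The value 0 when there is no k-th eigenvalue cannot be
   confused with a second eigenvalue of a connected graph, which is positive. *)
Definition lambdaN (k : nat) : R := xget 0 [set mu | is_kth_eigenvalue k mu].

(* With respect to the orientation of the edges; the same alternative holds on
   all edges. *)
Definition edgewise_monotonic (f : graph_fun) :=
  (forall e, {in on_edge e &, {homo f e : x y / x <= y}}) \/
  (forall e, {in on_edge e &, {homo f e : x y / x <= y >-> y <= x}}).

End Laplacian.

(* The metric graph with vertices V and edges E of lengths l, where the edges
   with l e <= 0 are contracted to points: a vertex of it is a chosen
   representative of a class of vertices joined by contracted edges. *)
Section Contraction.
Context {R : realType} {V E : finType} (s t : E -> V) (l : E -> R).

Definition contracted_adj : rel V := fun u v =>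
  [exists e, (l e <= 0) &&
     (((s e == u) && (t e == v)) || ((s e == v) && (t e == u)))].

Lemma contracted_sym : connect_sym contracted_adj.
Proof.
apply: sym_connect_sym => u v; apply: eq_existsb => e.
by rewrite orbC.
Qed.

Definition contraction_vertex : finType :=
  {v : V | v \in roots contracted_adj}.
Definition contraction_edge : finType := {e : E | 0 < l e}.

Definition vertex_class (v : V) : contraction_vertex :=
  exist _ (fingraph.root contracted_adj v) (roots_root contracted_sym v).

Definition contract_edges : metric_graph R :=
  @MetricGraph R contraction_vertex contraction_edge
    (fun e => vertex_class (s (val e))) (fun e => vertex_class (t (val e)))
    (fun e => l (val e)) (fun e => valP e).

End Contraction.

Section PumpkinOnAStick.
Context {R : realType}.

Definition v_minus : 'I_4 := @Ordinal 4 0 isT.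
Definition v_1 : 'I_4 := @Ordinal 4 1 isT.
Definition v_2 : 'I_4 := @Ordinal 4 2 isT.
Definition v_plus : 'I_4 := @Ordinal 4 3 isT.

(* inl false is the edge from v_minus to v_1, inl true the edge from v_2 to
   v_plus, and the inr i are the m parallel edges from v_1 to v_2. *)
Definition ps_edge (m : nat) : finType := (bool + 'I_m)%type.

Definition ps_src (m : nat) (e : ps_edge m) : 'I_4 :=
  match e with inl false => v_minus | inr _ => v_1 | inl true => v_2 end.

Definition ps_tgt (m : nat) (e : ps_edge m) : 'I_4 :=
  match e with inl false => v_1 | inr _ => v_2 | inl true => v_plus end.

Definition ps_len (L l1 : R) (m : nat) (l2 : R) (e : ps_edge m) : R :=
  match e with
  | inl false => l1
  | inr _ => (L - l1 - l2) / m%:R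
  | inl true => l2
  end.

Definition pumpkin_stick (L l1 : R) (m : nat) (l2 : R) : metric_graph R :=
  contract_edges (@ps_src m) (@ps_tgt m) (@ps_len L l1 m l2).

Definition lambda2_ps (L l1 : R) (m : nat) (l2 : R) : R :=
  lambdaN (pumpkin_stick L l1 m l2) 2.

(* The edge false is the loop, at the vertex false; the edge true is the tail,
   from the vertex false to the vertex true. *)
Definition tadpole (L tail : R) : metric_graph R :=
  contract_edges (fun _ : bool => false) (fun e : bool => e)
    (fun e : bool => if e then tail else L - tail).

Definition triangle (L : R) : set (R * R) :=
  [set p | [/\ 0 <= p.1, 0 <= p.2 & p.1 + p.2 <= L]].

End PumpkinOnAStick.

(* Main.v *)
Require Import Defs.
From HB Require Import structures.
From mathcomp Require Import all_boot all_order all_algebra.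
From mathcomp Require Import all_classical all_reals all_analysis.
From mathcomp Require Import ring lra.

Set Implicit Arguments.
Unset Strict Implicit.
Unset Printing Implicit Defensive.

Import Order.TTheory GRing.Theory Num.Theory.
Import numFieldNormedType.Exports.

Local Open Scope classical_set_scope.
Local Open Scope ring_scope.

(** The antisymmetric eigenfunctions on the parallel edges have frequency at
    least [pi] divided by the edge length, so below that frequency an
    eigenfunction of frequency [k] is a single wave which, at the vertex [v_1],
    passes from one edge to [m] edges: the value is kept and the slope is divided
    by [m]. In Pruefer coordinates the angle [x = k l1] is replaced by
    [phase m x], the continuous branch of [arctan (tan x / m)], and the frequency
    of the second eigenvalue is the unique root of
    [k (L - l1 - l2) / m + phase m (k l1) + phase m (k l2) = pi].
    All the monotonicity statements are read off the derivative
    [m / (m^2 cos^2 + sin^2)] of [phase m].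
    Eigenvalues [mu <= 0] are excluded without integration: the flux [f f'] is
    nondecreasing along every edge and its total increment is zero. *)

(** * Phase of a wave crossing a vertex *)

(** The number [pi] enters as the first positive zero of [sin]: matching at [v_2] the waves issued
    from [v_minus] and [v_plus] is a linear system whose determinant is [sin] of the phase sum.
    Strictly between 0 and [pi] it has only the zero solution; at [pi] it has a line of solutions.
    Roots are never computed for a comparison. As the phase sum increases with the frequency, two
    graphs are compared by evaluating the phase sum of one at the root of the other and looking at
    the side of [pi] on which it falls. Any of the lengths may be 0. To treat the closed triangle
    uniformly, eigenfunctions are studied on the uncontracted graph, with Kirchhoff's conditions
    tested against vertex functions that agree at the two ends of every contracted edge. *)

Section Phase.
Context {R : realType}.
Implicit Types m n x k L a b d : R.

Definition amplitude m x : R := Num.sqrt (m ^+ 2 * cos x ^+ 2 + sin x ^+ 2).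

(** The argument of [m cos x + i sin x], whose modulus is [amplitude m x]. The fraction is the
    imaginary part over the real part of [e^(ix)] times the conjugate of that number, so its
    arctangent is the angle between the two. For [m > 0] the denominator is positive, and no branch
    has to be chosen. *)
Definition phase m x : R :=
  x - atan ((m - 1) * (sin x * cos x) / (m * cos x ^+ 2 + sin x ^+ 2)).

Lemma sqr_cos_sin_gt0 m x : 0 < m -> 0 < m * cos x ^+ 2 + sin x ^+ 2.
Proof.
move=> m0; have := cos2Dsin2 x; have := sqr_ge0 (cos x).
have := sqr_ge0 (sin x); move: (cos x ^+ 2) (sin x ^+ 2) => c s s0 c0 cs.
case: (ltP 0 s) => [s_gt0|s_le0]; first by rewrite ltr_wpDl// mulr_ge0// ltW.
have -> : s = 0 by lra.
by rewrite addr0 mulr_gt0//; lra.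
Qed.

Lemma amplitude_gt0 m x : 0 < m -> 0 < amplitude m x.
Proof. by move=> m0; rewrite sqrtr_gt0 sqr_cos_sin_gt0// exprn_gt0. Qed.

Lemma sqr_amplitude m x : 0 < m ->
  amplitude m x ^+ 2 = m ^+ 2 * cos x ^+ 2 + sin x ^+ 2.
Proof. by move=> m0; rewrite sqr_sqrtr// ltW// sqr_cos_sin_gt0// exprn_gt0. Qed.

Lemma amplitude_phase m x : 0 < m ->
  amplitude m x * cos (phase m x) = m * cos x /\
  amplitude m x * sin (phase m x) = sin x.
Proof.
move=> m0; rewrite /phase; set q := m * _ + _.
set u := _ / q; have q0 : 0 < q by exact: sqr_cos_sin_gt0.
have qn0 := lt0r_neq0 q0; have cs := cos2Dsin2 x.
have a0 := amplitude_gt0 x m0; have an0 := lt0r_neq0 a0.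
have s2 : sin x ^+ 2 = 1 - cos x ^+ 2 by rewrite -cs addrC addKr.
have cq : cos (atan u) = q / amplitude m x.
  have -> : q / amplitude m x = (amplitude m x / q)^-1 by rewrite invf_div.
  rewrite cos_atan; congr (_^-1).
  rewrite -[RHS]ger0_norm ?divr_ge0 ?ltW// -sqrtr_sqr.
  congr Num.sqrt; rewrite [RHS]expr_div_n sqr_amplitude// /u expr_div_n.
  apply: (mulIf (expf_neq0 2 qn0)).
  rewrite mulrDl !divfK ?expf_neq0// mul1r /q s2 exprMn exprMn s2; ring.
have sq : sin (atan u) = u * cos (atan u).
  rewrite -[X in X * _](atanK u) /tan divfK// cos_atan invr_eq0 sqrtr_eq0 -ltNge.
  by rewrite ltr_pwDl// sqr_ge0.
have uq : u * q = (m - 1) * (sin x * cos x) by rewrite divfK.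
rewrite cosB sinB sq cq; split.
- rewrite (_ : amplitude m x * _ = cos x * q + sin x * (u * q)).
    by rewrite uq /q s2; ring: s2.
  by field.
- rewrite (_ : amplitude m x * _ = sin x * q - cos x * (u * q)).
    by rewrite uq /q s2; ring.
  by field.
Qed.

Lemma phase0 m : phase m 0 = 0.
Proof. by rewrite /phase sin0 !mul0r mulr0 mul0r atan0 subr0. Qed.

Lemma phasepi m : phase m pi = pi.
Proof. by rewrite /phase sinpi !mul0r mulr0 mul0r atan0 subr0. Qed.

Lemma phase_piB m x : phase m (pi - x) = pi - phase m x.
Proof.
rewrite /phase sinB cosB sinpi cospi !(mul0r, mulN1r, add0r, addr0, opprK).
by rewrite sqrrN mulrN mulrN mulNr atanN; ring.
Qed.

Lemma is_derive_phase m x : 0 < m ->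
  is_derive x 1 (phase m) (m / (m ^+ 2 * cos x ^+ 2 + sin x ^+ 2)).
Proof.
move=> m0; rewrite /phase.
set g := fun y : R => m * cos y ^+ 2 + sin y ^+ 2.
have q0 y : g y != 0 by exact/lt0r_neq0/sqr_cos_sin_gt0.
have dg : is_derive x 1 g (m * (- sin x * cos x *+ 2) + sin x * cos x *+ 2).
  apply: is_derive_eq; rewrite /GRing.scale/=; ring.
have dh : is_derive x 1 (fun y => (m - 1) * (sin y * cos y))
  ((m - 1) * (cos x ^+ 2 - sin x ^+ 2)).
  by apply: is_derive_eq; rewrite /GRing.scale/=; ring.
have dgi := is_deriveV (q0 x) dg.
have dq := is_deriveM dh dgi.
have da := is_derive1_comp (is_derive1_atan _) dq.
have db := is_deriveB (is_derive_id x 1) da.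
apply: (is_derive_eq db).
set r := m ^+ 2 * _ + _; set dgx := m * _ + _; set dw := (m - 1) * (_ - _).
have rn0 : r != 0 by rewrite lt0r_neq0// sqr_cos_sin_gt0// exprn_gt0.
have s2 := sin2cos2 x; have qx := q0 x.
pose w := (m - 1) * (sin x * cos x).
(* [g x + i w] is a unit complex number times one of modulus [amplitude m x], whence
   [g^2 + w^2 = r]. *)
have rE : 1 + (w / g x) ^+ 2 = r / g x ^+ 2.
  apply: (mulIf (expf_neq0 2 qx)); rewrite expr_div_n mulrDl !divfK ?expf_neq0//.
  by rewrite /w /g /r !exprMn s2; ring.
transitivity (1 - (1 + (w / g x) ^+ 2)^-1 *
    (w * (- g x ^- 2 * dgx) + (g x)^-1 * dw)); first by [].
rewrite rE invf_div (_ : m = r + w * dgx - g x * dw).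
  by field; rewrite qx rn0.
by rewrite /r /w /dgx /dw /g s2; ring: s2.
Qed.

(** Positivity is asked only in the open interval: the derivative compared in [phase_gap] vanishes
    at 0 and at [pi]. *)
Lemma lt_of_derive_gt0 (f df : R -> R) a b : a < b ->
  (forall x, is_derive x 1 f (df x)) ->
  (forall x, a < x < b -> 0 < df x) -> f a < f b.
Proof.
move=> ab fd df0; rewrite -subr_gt0.
have [|c cab ->] := MVT ab (fun x _ => fd x).
  by apply: derivable_within_continuous => x _; exact: ex_derive.
by rewrite mulr_gt0 ?subr_gt0// df0.
Qed.

(* [m * phase m] has derivative [1 / (cos^2 + sin^2 / m^2)], which increases
   with [m]. *)
Lemma phase_gap m n a b : 0 < m -> m < n -> 0 <= a -> a < b -> b <= pi ->
  m * (phase m b - phase m a) < n * (phase n b - phase n a).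
Proof.
move=> m0 mn a0 ab bpi; have n0 := lt_trans m0 mn.
pose f x := n * phase n x - m * phase m x.
suff : f a < f b by rewrite /f; lra.
pose df k x := k * (k / (k ^+ 2 * cos x ^+ 2 + sin x ^+ 2)).
have fd (x : R) : is_derive x 1 f (df n x - df m x).
  exact: is_deriveB (is_deriveZ n (is_derive_phase x n0))
                    (is_deriveZ m (is_derive_phase x m0)).
apply: (lt_of_derive_gt0 ab fd) => x.
move=> /andP[ax xb]; rewrite subr_gt0 /df.
have s0 : 0 < sin x by rewrite sin_gt0_pi// (le_lt_trans a0)// (lt_le_trans xb).
rewrite (mulrA m) (mulrA n) ltr_pdivrMr ?sqr_cos_sin_gt0 ?exprn_gt0//.
rewrite mulrAC ltr_pdivlMr ?sqr_cos_sin_gt0 ?exprn_gt0//.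
rewrite -subr_gt0 (_ : _ - _ = (n - m) * (n + m) * sin x ^+ 2); last by ring.
by rewrite !mulr_gt0 ?exprn_gt0// ?subr_gt0// addr_gt0.
Qed.

Lemma phase_incr m a b : 0 < m -> a < b -> phase m a < phase m b.
Proof.
move=> m0 ab; apply: (lt_of_derive_gt0 ab (fun x => is_derive_phase x m0)) => x _.
by rewrite divr_gt0 ?sqr_cos_sin_gt0// exprn_gt0.
Qed.

Lemma continuous_phase m : 0 < m -> continuous (phase m).
Proof.
move=> m0 x; apply/differentiable_continuous/derivable1_diffP.
have dp := is_derive_phase x m0; exact: ex_derive.
Qed.

(* The derivative of [phase m] is symmetric and peaked at [pi / 2], so an
   interval gains phase when it is moved towards being centred there. *)
Lemma phase_shift m a b d : 1 < m -> 0 < d -> 0 < b - a < pi ->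
  0 <= a + b -> a + b + d *+ 2 <= pi ->
  phase m b - phase m a < phase m (b + d) - phase m (a + d).
Proof.
move=> m1 d0 /andP[ab bapi] ab0 abpi; have m0 := lt_trans ltr01 m1.
pose f t := phase m (b + t) - phase m (a + t).
suff : f 0 < f d by rewrite /f !addr0.
pose g x := m / (m ^+ 2 * cos x ^+ 2 + sin x ^+ 2).
have dshift (c t : R) : is_derive t 1 (fun t => phase m (c + t)) (g (c + t)).
  have dc : is_derive t (1 : R) (fun t : R => c + t) 1.
    apply: (is_derive_eq (is_deriveD (is_derive_cst c t 1) (is_derive_id t 1))).
    exact: add0r.
  have := is_derive1_comp (is_derive_phase (c + t) m0) dc.
  by rewrite mulr1.
have fd (t : R) : is_derive t 1 f (g (b + t) - g (a + t)).
  exact: is_deriveB (dshift b t) (dshift a t).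
apply: (lt_of_derive_gt0 d0 fd) => t.
move=> /andP[t0 td]; rewrite /g subr_gt0 ltr_pM2l// ltf_pV2 ?posrE; last 2 first.
- by rewrite sqr_cos_sin_gt0// exprn_gt0.
- by rewrite sqr_cos_sin_gt0// exprn_gt0.
rewrite -subr_gt0 (_ : _ - _ =
    (m ^+ 2 - 1) * (sin (b + t) ^+ 2 - sin (a + t) ^+ 2)); last first.
  by rewrite (cos2sin2 (a + t)) (cos2sin2 (b + t)); ring.
rewrite mulr_gt0//.
  by rewrite subr_gt0 exprn_egt1.
(* The first sine sees the length of the interval, the second twice its midpoint; the hypotheses put
   both arguments strictly between 0 and [pi]. *)
have -> : sin (b + t) ^+ 2 - sin (a + t) ^+ 2 =
    sin (b + t - (a + t)) * sin (b + t + (a + t)).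
  rewrite (sinB (b + t)) (sinD (b + t)).
  by ring: (sin2cos2 (a + t)) (sin2cos2 (b + t)).
by rewrite mulr_gt0// sin_gt0_pi//; apply/andP; split; lra.
Qed.

End Phase.

(** * The secular equation *)

Section PhaseSum.
Context {R : realType}.
Implicit Types k l m n x a b L : R.

Definition phase_sum L l1 m l2 k : R :=
  k * ((L - l1 - l2) / m) + phase m (k * l1) + phase m (k * l2).

Definition resonant L l1 m l2 k := 0 < k /\ phase_sum L l1 m l2 k = pi.

Lemma phase_le m a b : 0 < m -> a <= b -> phase m a <= phase m b.
Proof. by move=> m0; rewrite le_eqVlt => /predU1P[->//|/(phase_incr m0)/ltW]. Qed.

Lemma phase_ge0 m x : 0 < m -> 0 <= x -> 0 <= phase m x.
Proof. by move=> m0 x0; rewrite -(phase0 m) phase_le. Qed.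

Lemma phase1 x : phase 1 x = x.
Proof. by rewrite /phase subrr !mul0r atan0 subr0. Qed.

(* The case [m = 1] of [phase_gap], where [phase 1] is the identity. *)
Lemma phase_gap1 m a b : 1 < m -> 0 <= a -> a < b -> b <= pi ->
  (b - a) / m < phase m b - phase m a.
Proof.
move=> m1 a0 ab bpi; have m0 := lt_trans ltr01 m1.
rewrite ltr_pdivrMr// [ltRHS]mulrC.
by have := phase_gap ltr01 m1 a0 ab bpi; rewrite !phase1 mul1r.
Qed.

Lemma phase_sum0 L l1 m l2 : phase_sum L l1 m l2 0 = 0.
Proof. by rewrite /phase_sum !mul0r phase0 !addr0. Qed.

Lemma phase_sumC L l1 m l2 : phase_sum L l1 m l2 = phase_sum L l2 m l1.
Proof. by apply/funext => k; rewrite /phase_sum addrAC (addrAC L). Qed.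

Lemma phase_sum_incr L l1 m l2 a b : 0 < L -> 0 < m -> triangle L (l1, l2) ->
  a < b -> phase_sum L l1 m l2 a < phase_sum L l1 m l2 b.
Proof.
move=> L0 m0 [/= l10 l20 lL] ab; rewrite /phase_sum.
have p (l : R) : 0 <= l ->
    phase m (a * l) <= phase m (b * l) ?= iff (l == 0).
  rewrite le_eqVlt => /predU1P[<-|l0]; first by rewrite !mulr0 eqxx; exact/leif_refl.
  rewrite gt_eqF//; apply/leifP.
  by rewrite phase_incr// ltr_pM2r.
have [p1 e1] := p _ l10; have [p2 e2] := p _ l20.
have d0 : 0 <= (L - l1 - l2) / m by rewrite divr_ge0 ?(ltW m0)//; lra.
have p3 := ler_wpM2r d0 (ltW ab).
rewrite lt_neqAle; apply/andP; split; last lra.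
(* If nothing grew, both sticks would have length 0; but then the parallel edges have length [L / m]
   and their term does grow. *)
apply/eqP => e.
have /eqP : phase m (a * l1) = phase m (b * l1) by lra.
have /eqP : phase m (a * l2) = phase m (b * l2) by lra.
rewrite e1 e2 => /eqP l2E /eqP l1E; move: p3 e.
rewrite l1E l2E !mulr0 !phase0 !subr0 !addr0 => _ /eqP; apply/negP.
by rewrite lt_eqF// ltr_pM2r// divr_gt0.
Qed.

Lemma phase_sum_lt L l1 m l2 a b : 0 < L -> 0 < m -> triangle L (l1, l2) ->
  (phase_sum L l1 m l2 a < phase_sum L l1 m l2 b) = (a < b).
Proof.
move=> L0 m0 T; apply/idP/idP; last exact: phase_sum_incr.
by apply: contraTT; rewrite -!leNgt le_eqVlt => /predU1P[->//|/phase_sum_incr/ltW]; exact.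
Qed.

Lemma continuous_phase_sum L m : 0 < m ->
  continuous (fun p : R * R * R => phase_sum L p.1.1 m p.1.2 p.2).
Proof.
move=> m0 [[l1 l2] k]; rewrite /phase_sum.
have c11 : (fun p : R * R * R => p.1.1) @ (l1, l2, k) --> l1.
  by apply: (cvg_comp _ _ cvg_fst); exact: cvg_fst.
have c12 : (fun p : R * R * R => p.1.2) @ (l1, l2, k) --> l2.
  by apply: (cvg_comp _ _ cvg_fst); exact: cvg_snd.
have c2 : (fun p : R * R * R => p.2) @ (l1, l2, k) --> k by exact: cvg_snd.
apply: cvgD; first apply: cvgD.
- apply: cvgM => //; apply: cvgMl; apply: cvgB => //; apply: cvgB => //.
  exact: cvg_cst.
- have c : (fun p : R * R * R => p.2 * p.1.1) @ (l1, l2, k) --> k * l1.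
    exact: cvgM.
  exact: (cvg_comp _ _ c (continuous_phase m0 (x := k * l1))).
- have c : (fun p : R * R * R => p.2 * p.1.2) @ (l1, l2, k) --> k * l2.
    exact: cvgM.
  exact: (cvg_comp _ _ c (continuous_phase m0 (x := k * l2))).
Qed.

Lemma phase_lowerbound m x : 1 < m -> 0 <= x -> x <= pi ->
  x / m <= phase m x ?= iff (x == 0).
Proof.
move=> m1; rewrite le_eqVlt => /predU1P[<- _|x0 xpi].
  by rewrite mul0r phase0 eqxx; exact/leif_refl.
rewrite gt_eqF//; apply/leifP.
by have := phase_gap1 m1 (lexx 0) x0 xpi; rewrite subr0 phase0 subr0.
Qed.

Lemma exists_resonant L l1 m l2 : 0 < L -> 1 < m -> triangle L (l1, l2) ->
  exists k, resonant L l1 m l2 k.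
Proof.
move=> L0 m1 T; have m0 := lt_trans ltr01 m1.
(* [K] is the root for the pumpkin. Since [x / m <= phase m x] on [[0, pi]], the phase sum at [K] is
   at least [K * L / m = pi]. *)
have [/= l10 l20 lL] := T; pose K := pi * m / L.
have K0 : 0 < K by rewrite divr_gt0// mulr_gt0// pi_gt0.
have d0 : 0 <= (L - l1 - l2) / m by rewrite divr_ge0 ?(ltW m0)//; lra.
have Kd0 : 0 <= K * ((L - l1 - l2) / m) by rewrite mulr_ge0// ltW.
have p1 : 0 <= phase m (K * l1) by rewrite phase_ge0// mulr_ge0// ltW.
have p2 : 0 <= phase m (K * l2) by rewrite phase_ge0// mulr_ge0// ltW.
have FK : pi <= phase_sum L l1 m l2 K.
  (* A stick whose angle leaves [[0, pi]] contributes at least [pi] on its own. *)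
  rewrite /phase_sum; have [Kl1|Kl1] := leP pi (K * l1).
    by have := phase_le m0 Kl1; rewrite phasepi; lra.
  have [Kl2|Kl2] := leP pi (K * l2).
    by have := phase_le m0 Kl2; rewrite phasepi; lra.
  have [h1 _] := phase_lowerbound m1 (mulr_ge0 (ltW K0) l10) (ltW Kl1).
  have [h2 _] := phase_lowerbound m1 (mulr_ge0 (ltW K0) l20) (ltW Kl2).
  have -> : pi = K * ((L - l1 - l2) / m) + K * l1 / m + K * l2 / m.
    by rewrite /K; field; rewrite !lt0r_neq0.
  by rewrite !lerD.
have [||k] := @IVT R (phase_sum L l1 m l2) 0 K pi (ltW K0).
- apply: continuous_subspaceT => k.
  have c : (fun k : R => (l1, l2, k)) @ k --> (l1, l2, k).
    exact: cvg_pair (cvg_cst (l1, l2)) cvg_id.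
  exact: (cvg_comp _ _ c (@continuous_phase_sum L m m0 (l1, l2, k))).
- by rewrite phase_sum0 ge_min le_max pi_ge0 FK orbT.
rewrite in_itv/= => /andP[k0 _] kpi; exists k; split=> //.
rewrite lt_neqAle k0 andbT; apply/eqP => k00.
by move: kpi; rewrite -k00 phase_sum0 => p0; have := pi_gt0 R; rewrite -p0 ltxx.
Qed.

(** Three nonnegative terms add up to [pi], so none exceeds it; as [phase m pi = pi], the stick
    angles stay in [[0, pi]], the range of [phase_gap]. *)
Lemma resonant_phase_le L l1 m l2 k : 0 < m -> triangle L (l1, l2) ->
  resonant L l1 m l2 k ->
  [/\ 0 <= k * ((L - l1 - l2) / m),
      0 <= phase m (k * l1), 0 <= phase m (k * l2),
      k * l1 <= pi & k * l2 <= pi].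
Proof.
move=> m0 [/= l10 l20 lL] [k0]; rewrite /phase_sum => kpi.
have d0 : 0 <= k * ((L - l1 - l2) / m).
  by rewrite mulr_ge0 ?(ltW k0)// divr_ge0 ?(ltW m0)//; lra.
have p1 : 0 <= phase m (k * l1) by rewrite phase_ge0// mulr_ge0// ltW.
have p2 : 0 <= phase m (k * l2) by rewrite phase_ge0// mulr_ge0// ltW.
split=> //; rewrite leNgt; apply/negP => /(phase_incr m0).
- by rewrite phasepi; lra.
- by rewrite phasepi; lra.
Qed.

Lemma resonant_lt L l1 m l2 l1' m' l2' k k' : 0 < L -> 0 < m' ->
  triangle L (l1', l2') -> resonant L l1 m l2 k -> resonant L l1' m' l2' k' ->
  (k' < k) = (pi < phase_sum L l1' m' l2' k).
Proof. by move=> L0 m0 T [_ _] [_ <-]; rewrite phase_sum_lt. Qed.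

Lemma resonant_gt L l1 m l2 l1' m' l2' k k' : 0 < L -> 0 < m' ->
  triangle L (l1', l2') -> resonant L l1 m l2 k -> resonant L l1' m' l2' k' ->
  (k < k') = (phase_sum L l1' m' l2' k < pi).
Proof. by move=> L0 m0 T [_ _] [_ <-]; rewrite phase_sum_lt. Qed.

Lemma resonant_inj L l1 m l2 k k' : 0 < L -> 0 < m -> triangle L (l1, l2) ->
  resonant L l1 m l2 k -> resonant L l1 m l2 k' -> k = k'.
Proof.
move=> L0 m0 T h h'; have := resonant_lt L0 m0 T h h'.
by have := resonant_lt L0 m0 T h' h; rewrite h.2 h'.2 ltxx; case: ltgtP.
Qed.

(** Length taken from the parallel edges loses phase at the rate [k / m]; given to a stick it gains
    phase at a larger mean rate. The sum at the old root thus exceeds [pi]. *)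
Lemma resonant_anti L l1 m l2 l1' l2' k k' : 0 < L -> 1 < m ->
  triangle L (l1, l2) -> triangle L (l1', l2') ->
  resonant L l1 m l2 k -> resonant L l1' m l2' k' ->
  l1 <= l1' -> l2 <= l2' -> (l1 < l1') || (l2 < l2') -> k' < k.
Proof.
move=> L0 m1 T T' r r' h1 h2 h; have m0 := lt_trans ltr01 m1.
rewrite (resonant_lt L0 m0 T' r r').
have [k0 rE] := r; have [/= l10 l20 lL] := T; have [/= l10' l20' lL'] := T'.
have [d0 p1 p2 kl1 kl2] := resonant_phase_le m0 T r.
have d0' : 0 <= k * ((L - l1' - l2') / m).
  by rewrite mulr_ge0 ?(ltW k0)// divr_ge0 ?(ltW m0)//; lra.
have p1' : phase m (k * l1) <= phase m (k * l1') by rewrite phase_le// ler_pM2l.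
have p2' : phase m (k * l2) <= phase m (k * l2') by rewrite phase_le// ler_pM2l.
(* At the old frequency a lengthened stick may have an angle beyond [pi]; its phase alone then
   exceeds [pi]. *)
rewrite /phase_sum; have [Kl1|Kl1] := leP (k * l1') pi; last first.
  by have := phase_incr m0 Kl1; rewrite phasepi; lra.
have [Kl2|Kl2] := leP (k * l2') pi; last first.
  by have := phase_incr m0 Kl2; rewrite phasepi; lra.
have gap l l' : 0 <= l -> l <= l' -> k * l' <= pi ->
    (k * l' - k * l) / m <= phase m (k * l') - phase m (k * l) ?= iff (l == l').
  move=> l0; rewrite le_eqVlt => /predU1P[->|ll'] kpi.
    by rewrite !subrr mul0r eqxx; exact/leif_refl.
  rewrite lt_eqF//; apply/leifP; apply: phase_gap1 => //.
    by rewrite mulr_ge0// ltW.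
  by rewrite ltr_pM2l.
have [g1 e1] := gap _ _ l10 h1 Kl1; have [g2 e2] := gap _ _ l20 h2 Kl2.
rewrite -rE /phase_sum.
have -> : k * ((L - l1 - l2) / m) = k * ((L - l1' - l2') / m) +
    (k * l1' - k * l1) / m + (k * l2' - k * l2) / m by field; rewrite lt0r_neq0.
rewrite lt_neqAle; apply/andP; split; last lra.
apply/eqP => e.
have /eqP : (k * l1' - k * l1) / m = phase m (k * l1') - phase m (k * l1) by lra.
have /eqP : (k * l2' - k * l2) / m = phase m (k * l2') - phase m (k * l2) by lra.
by rewrite e1 e2 => /eqP e2' /eqP e1'; move: h; rewrite e1' e2' !ltxx.
Qed.

(* Multiplying [phase_sum = pi] by [m] and reflecting the second stick by
   [phase_piB] turns the equation into one about the growth of [m * phase m]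
   on the interval from [k * l1] to [pi - k * l2]. *)
Lemma phase_sumE L l1 m l2 k : 0 < m ->
  m * (phase_sum L l1 m l2 k - pi) = k * (L - l1 - l2) -
    m * (phase m (pi - k * l2) - phase m (k * l1)).
Proof.
by move=> m0; rewrite /phase_sum phase_piB; field; rewrite lt0r_neq0.
Qed.

Lemma resonant_interval L l1 m l2 k : 0 < m -> l1 + l2 < L ->
  resonant L l1 m l2 k ->
  k * (L - l1 - l2) = m * (phase m (pi - k * l2) - phase m (k * l1)) /\
  k * l1 < pi - k * l2.
Proof.
move=> m0 lL [k0 rE]; have := phase_sumE L l1 l2 k m0.
rewrite rE subrr mulr0 => /esym/eqP; rewrite subr_eq0 => /eqP e; split=> //.
rewrite ltNge; apply/negP => /(phase_le m0) h.
have : 0 < k * (L - l1 - l2) by rewrite mulr_gt0//; lra.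
by rewrite e pmulr_rgt0//; lra.
Qed.

(** In the form of [phase_sumE], the term [k * (L - l1 - l2)] is independent of [m], while the
    growth subtracted from it increases strictly with [m] by [phase_gap]. *)
Lemma resonant_incr_m L l1 m n l2 k k' : 0 < L -> 0 < m -> m < n ->
  triangle L (l1, l2) -> l1 + l2 < L ->
  resonant L l1 m l2 k -> resonant L l1 n l2 k' -> k < k'.
Proof.
move=> L0 m0 mn T lL r r'; have n0 := lt_trans m0 mn.
have [/= l10 l20 _] := T; have k0 := r.1.
rewrite (resonant_gt L0 n0 T r r') -subr_lt0 -(pmulr_rlt0 _ n0) phase_sumE//.
have [-> h] := resonant_interval m0 lL r.
rewrite subr_lt0; apply: phase_gap => //; first by rewrite mulr_ge0// ltW.
by rewrite gerBl mulr_ge0// ltW.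
Qed.

(** For fixed [l] the interval from [k * l1] to [pi - k * (l - l1)] keeps its length [pi - k * l]
    and is translated by [k * (l1' - l1)]. Its midpoint stays at or below [pi / 2] exactly as long
    as [l1' <= l / 2], so [phase_shift] applies. *)
Lemma resonant_incr_shift L l m l1 l1' k k' : 0 < L -> 1 < m -> l < L ->
  0 <= l1 -> l1 < l1' -> l1' <= l / 2 ->
  resonant L l1 m (l - l1) k -> resonant L l1' m (l - l1') k' -> k < k'.
Proof.
move=> L0 m1 lL l10 ll' l'l r r'; have m0 := lt_trans ltr01 m1.
have T : triangle L (l1, l - l1) by split=> /=; lra.
have T' : triangle L (l1', l - l1') by split=> /=; lra.
have k0 := r.1.
rewrite (resonant_gt L0 m0 T' r r') -subr_lt0 -(pmulr_rlt0 _ m0) phase_sumE//.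
have -> : L - l1' - (l - l1') = L - l1 - (l - l1) by ring.
have [|-> h] := resonant_interval m0 _ r; first lra.
have [_ _ _ _ kl2] := resonant_phase_le m0 T r.
rewrite subr_lt0 ltr_pM2l//.
have d0 : 0 < k * (l1' - l1) by rewrite mulr_gt0// subr_gt0.
have kl0 : 0 < k * l by rewrite mulr_gt0//; lra.
have kl1 : 0 <= k * l1 by rewrite mulr_ge0// ltW.
have kc : 0 <= k * (l / 2 - l1') by rewrite mulr_ge0 ?(ltW k0)//; lra.
have := @phase_shift _ m (k * l1) (pi - k * (l - l1)) (k * (l1' - l1)) m1 d0.
have -> : pi - k * (l - l1) + k * (l1' - l1) = pi - k * (l - l1') by ring.
have -> : k * l1 + k * (l1' - l1) = k * l1' by ring.
by apply; [apply/andP; split|..]; lra.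
Qed.

(** At [pi / L] the two stick angles add up to [pi]; by reflection so do their phases, whatever [m]
    is. *)
Lemma resonant_path L l1 m k : 0 < L -> 1 < m -> triangle L (l1, L - l1) ->
  resonant L l1 m (L - l1) k -> k = pi / L.
Proof.
move=> L0 m1 T r; have m0 := lt_trans ltr01 m1.
apply: (resonant_inj L0 m0 T r); split; first by rewrite divr_gt0 ?pi_gt0.
rewrite /phase_sum; have -> : pi / L * (L - l1) = pi - pi / L * l1.
  by field; rewrite lt0r_neq0.
by rewrite phase_piB; ring.
Qed.

(** Comparison with the path obtained by lengthening the second stick until the parallel edges
    vanish. *)
Lemma resonant_lowerbound L l1 m l2 k : 0 < L -> 1 < m -> triangle L (l1, l2) ->
  resonant L l1 m l2 k -> pi / L <= k ?= iff (l1 + l2 == L).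
Proof.
move=> L0 m1 T r; have [/= l10 l20 lL] := T.
have T' : triangle L (l1, L - l1) by split=> /=; lra.
have [k' r'] := exists_resonant L0 m1 T'.
rewrite -(resonant_path L0 m1 T' r').
have [lE|lE] := eqVneq (l1 + l2) L.
  have l2E : L - l1 = l2 by lra.
  by rewrite l2E in r'; rewrite (resonant_inj L0 (lt_trans ltr01 m1) T r r'); exact/leif_refl.
have lL' : l1 + l2 < L by rewrite lt_neqAle lE.
apply/leifP; apply: (resonant_anti L0 m1 T T' r r') => //; first lra.
by apply/orP; right; lra.
Qed.

(** Each stick of length [l] contributes at least [k * l / m], so [k * L / m <= pi]; equality makes
    both stick bounds tight, which happens only at length 0. *)
Lemma resonant_upperbound L l1 m l2 k : 0 < L -> 1 < m -> triangle L (l1, l2) ->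
  resonant L l1 m l2 k -> k <= pi * m / L ?= iff (l1 + l2 == 0).
Proof.
move=> L0 m1 T r; have m0 := lt_trans ltr01 m1; have [/= l10 l20 lL] := T.
have [d0 p1 p2 kl1 kl2] := resonant_phase_le m0 T r; have [k0 rE] := r.
have [h1 e1] := phase_lowerbound m1 (mulr_ge0 (ltW k0) l10) kl1.
have [h2 e2] := phase_lowerbound m1 (mulr_ge0 (ltW k0) l20) kl2.
have kE : k = (k * ((L - l1 - l2) / m) + k * l1 / m + k * l2 / m) * m / L.
  by field; rewrite !lt0r_neq0.
have le_pi : k * ((L - l1 - l2) / m) + k * l1 / m + k * l2 / m <= pi.
  by rewrite -rE !lerD.
split; first by rewrite [leLHS]kE ler_pM2r ?invr_gt0// ler_pM2r.
rewrite [X in X == _]kE; apply/eqP/eqP.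
  move=> /(mulIf _) /=; rewrite invr_eq0 lt0r_neq0// => /(_ isT).
  move=> /(mulIf (lt0r_neq0 m0)); rewrite -rE /phase_sum => e.
  have /eqP : k * l1 / m = phase m (k * l1) by lra.
  have /eqP : k * l2 / m = phase m (k * l2) by lra.
  rewrite e1 e2 !mulf_eq0 gt_eqF//= => /eqP -> /eqP ->; exact: addr0.
move=> l0; have l1E : l1 = 0 by lra.
have l2E : l2 = 0 by lra.
move: rE; rewrite /phase_sum l1E l2E !mulr0 !phase0 => <-.
by rewrite !mul0r.
Qed.

End PhaseSum.

(** * Eigenfunctions on metric graphs and their contractions *)

Section Edge.
Context {R : realType}.
Implicit Types (f : R -> R) (a b x y k mu : R).

Lemma eq_of_derive_eq0 f a b x y : x \in `[a, b] -> y \in `[a, b] ->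
  (forall z, z \in `[a, b] -> is_derive z 1 f 0) -> f x = f y.
Proof.
wlog xy : x y / x <= y.
  move=> wlg xab yab d; case: (leP x y) => [/wlg|/ltW/wlg h]; first exact.
  exact/esym/h.
rewrite !in_itv/= => /andP[ax xb] /andP[ay yb] d.
have dxy z : z \in `[x, y] -> is_derive z 1 f 0.
  rewrite in_itv/= => /andP[xz zy]; apply: d.
  by rewrite in_itv/= (le_trans ax xz) (le_trans zy yb).
have dxy' z : z \in `]x, y[ -> is_derive z 1 f 0 by move=> /subset_itv_oo_cc/dxy.
have cf : {within `[x, y], continuous f}.
  by apply: derivable_within_continuous => z /dxy dz; exact: ex_derive.
have [c _] := MVT_segment xy dxy' cf.
by rewrite mul0r => /subr0_eq.
Qed.

Lemma solution_on_edge f k a b x y : k != 0 ->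
  (forall z, z \in `[a, b] -> [/\ derivable f z 1, derivable (derive1 f) z 1
     & - derive1 (derive1 f) z = k ^+ 2 * f z]) ->
  x \in `[a, b] -> y \in `[a, b] ->
  f y = f x * cos (k * (y - x)) + derive1 f x / k * sin (k * (y - x)) /\
  derive1 f y = - (k * f x * sin (k * (y - x))) + derive1 f x * cos (k * (y - x)).
Proof.
move=> k0 fs xab yab.
have df z : z \in `[a, b] -> is_derive z 1 f (derive1 f z).
  by move=> /fs[h _ _]; rewrite derive1E; exact/derivableP.
have ddf z : z \in `[a, b] -> is_derive z 1 (derive1 f) (- (k ^+ 2 * f z)).
  move=> /fs[_ h <-]; rewrite opprK (derive1E (derive1 f)); exact/derivableP.
have dk (z : R) : is_derive z 1 (fun w : R => k * (w - x)) k.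
  apply: (is_derive_eq (is_deriveZ k (is_deriveB (is_derive_id z 1) (is_derive_cst x z 1)))).
  by rewrite subr0 /GRing.scale/= mulr1.
have dc (z : R) : is_derive z 1 (fun w => cos (k * (w - x))) (- sin (k * (z - x)) * k).
  exact: is_derive1_comp (is_derive_cos _) (dk z).
have ds (z : R) : is_derive z 1 (fun w => sin (k * (w - x))) (cos (k * (z - x)) * k).
  exact: is_derive1_comp (is_derive_sin _) (dk z).
(* The vector [(f, f' / k)] rotates at speed [k]; [A] and [B] are its coordinates after undoing the
   rotation since [x], hence conserved. *)
pose A z := f z * cos (k * (z - x)) - k^-1 * (derive1 f z * sin (k * (z - x))).
pose B z := f z * sin (k * (z - x)) + k^-1 * (derive1 f z * cos (k * (z - x))).
have dA z : z \in `[a, b] -> is_derive z 1 A 0.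
  move=> zab; apply: (is_derive_eq (is_deriveB (is_deriveM (df z zab) (dc z))
    (is_deriveZ k^-1 (is_deriveM (ddf z zab) (ds z))))).
  by rewrite /GRing.scale/=; field.
have dB z : z \in `[a, b] -> is_derive z 1 B 0.
  move=> zab; apply: (is_derive_eq (is_deriveD (is_deriveM (df z zab) (ds z))
    (is_deriveZ k^-1 (is_deriveM (ddf z zab) (dc z))))).
  by rewrite /GRing.scale/=; field.
have := eq_of_derive_eq0 yab xab dA; have := eq_of_derive_eq0 yab xab dB.
rewrite /A /B subrr mulr0 sin0 cos0 !mulr0 !mulr1 subr0 add0r => eB eA.
have cs := sin2cos2 (k * (y - x)).
move: eA eB cs; move: (cos _) (sin _) (f y) (f x) (derive1 f y) (derive1 f x).
move=> c s fy fx gy gx eA eB cs.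
have -> : fx = fy * c - k^-1 * (gy * s) by rewrite eA.
have -> : gx = k * (fy * s + k^-1 * (gy * c)) by rewrite eB; field.
split; first by field: cs.
by field: cs.
Qed.

(* The flux [f f'] is nondecreasing on the edge, hence constant if it has the
   same value at both ends. *)
Lemma solution_flux f mu b : 0 <= b -> mu <= 0 ->
  (forall z, z \in `[0, b] -> [/\ derivable f z 1, derivable (derive1 f) z 1
     & - derive1 (derive1 f) z = mu * f z]) ->
  f 0 * derive1 f 0 <= f b * derive1 f b /\
  (f 0 * derive1 f 0 = f b * derive1 f b ->
   forall x, x \in `[0, b] -> f x = f 0).
Proof.
move=> b0 mu0 fs.
have df z : z \in `[0, b] -> is_derive z 1 f (derive1 f z).
  by move=> /fs[h _ _]; rewrite derive1E; exact/derivableP.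
have ddf z : z \in `[0, b] -> is_derive z 1 (derive1 f) (- (mu * f z)).
  move=> /fs[_ h <-]; rewrite opprK (derive1E (derive1 f)); exact/derivableP.
pose g z := f z * derive1 f z.
have dg z : z \in `[0, b] ->
    is_derive z 1 g (derive1 f z ^+ 2 - mu * f z ^+ 2).
  move=> zb; apply: (is_derive_eq (is_deriveM (df z zb) (ddf z zb))).
  by rewrite /GRing.scale/=; ring.
have dg1 z : z \in `[0, b] -> derive1 g z = derive1 f z ^+ 2 - mu * f z ^+ 2.
  by move=> /dg ?; rewrite derive1E derive_val.
have dg0 z : 0 <= derive1 f z ^+ 2 - mu * f z ^+ 2.
  by rewrite -mulNr addr_ge0 ?sqr_ge0// mulr_ge0 ?sqr_ge0// oppr_ge0.
have gD z : z \in `]0, b[ -> derivable g z 1.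
  by move=> /subset_itv_oo_cc/dg ?; exact: ex_derive.
have gC : {within `[0, b], continuous g}.
  by apply: derivable_within_continuous => z /dg ?; exact: ex_derive.
have gle x y : 0 <= x -> x <= y -> y <= b -> g x <= g y.
  apply: (ger0_derive1_ndecr gD) => // z /subset_itv_oo_cc zb.
  by rewrite dg1// dg0.
split=> [|e]; first by apply: (gle 0 b).
have gE x : 0 <= x <= b -> g x = g 0.
  move=> /andP[x0 xb]; apply/eqP; rewrite eq_le; apply/andP; split; last exact: gle.
  by rewrite (_ : g 0 = g b)//; exact: gle.
(* Only at interior points is [g] known to be constant on a two-sided neighbourhood, so that its
   derivative vanishes. That derivative is a sum of two nonnegative terms, one of them [f'^2]. *)
have df0 z : z \in `]0, b[ -> derive1 f z = 0.
  move=> zb; have zb' := subset_itv_oo_cc zb.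
  have : derive1 g z = 0.
    rewrite derive1E -(derive_cst (g 0) z 1); apply: near_eq_derive.
    near=> w; apply: gE; have : w \in `]0, b[ by near: w; exact: near_in_itvoo.
    by rewrite in_itv/= => /andP[/ltW-> /ltW].
  rewrite dg1// => h; apply/eqP; rewrite -sqrf_eq0; apply/eqP.
  have := sqr_ge0 (derive1 f z).
  have : 0 <= - mu * f z ^+ 2 by rewrite mulr_ge0 ?sqr_ge0// oppr_ge0.
  by lra.
move=> x; rewrite in_itv/= => /andP[x0 xb].
have dx z : z \in `]0, x[ -> is_derive z 1 f 0.
  rewrite in_itv/= => /andP[z0 zx].
  have zb : z \in `]0, b[ by rewrite in_itv/= z0 (lt_le_trans zx xb).
  by rewrite -(df0 z zb); apply: df; exact: subset_itv_oo_cc.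
have cf : {within `[0, x], continuous f}.
  apply: derivable_within_continuous => z; rewrite in_itv/= => /andP[z0 zx].
  have zb : z \in `[0, b] by rewrite in_itv/= z0 (le_trans zx xb).
  by have dz := df z zb; exact: ex_derive.
have [c _] := MVT_segment x0 dx cf.
by rewrite mul0r => /subr0_eq.
Unshelve. all: by end_near. Qed.

Lemma is_derive_cos_affine k b x :
  is_derive x 1 (fun y => cos (k * y + b)) (- (k * sin (k * x + b))).
Proof.
have dk : is_derive x 1 (fun y : R => k * y + b) k.
  apply: (is_derive_eq (is_deriveD (is_deriveZ k (is_derive_id x 1)) (is_derive_cst b x 1))).
  by rewrite addr0 /GRing.scale/= mulr1.
apply: (is_derive_eq (is_derive1_comp (is_derive_cos _) dk)).
by rewrite mulNr mulrC.
Qed.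

Lemma is_derive_sin_affine k b x :
  is_derive x 1 (fun y => sin (k * y + b)) (k * cos (k * x + b)).
Proof.
have dk : is_derive x 1 (fun y : R => k * y + b) k.
  apply: (is_derive_eq (is_deriveD (is_deriveZ k (is_derive_id x 1)) (is_derive_cst b x 1))).
  by rewrite addr0 /GRing.scale/= mulr1.
apply: (is_derive_eq (is_derive1_comp (is_derive_sin _) dk)).
by rewrite mulrC.
Qed.

Definition wave c k b x : R := c * cos (k * x + b).

Lemma derive1_wave c k b x :
  derive1 (wave c k b) x = - (c * k * sin (k * x + b)).
Proof.
have d := is_deriveZ c (is_derive_cos_affine k b x).
by rewrite derive1E derive_val /GRing.scale/=; ring.
Qed.

Lemma wave_solves c k b x : [/\ derivable (wave c k b) x 1,
  derivable (derive1 (wave c k b)) x 1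
  & - derive1 (derive1 (wave c k b)) x = k ^+ 2 * wave c k b x].
Proof.
have d := is_deriveZ c (is_derive_cos_affine k b x).
have d1 := is_deriveZ (- (c * k)) (is_derive_sin_affine k b x).
have -> : derive1 (wave c k b) = (- (c * k)) \*: (fun y => sin (k * y + b)).
  by apply/funext => y; rewrite derive1_wave -mulNr.
split; [exact: ex_derive|exact: ex_derive|].
by rewrite derive1E derive_val /wave /GRing.scale/=; ring.
Qed.

End Edge.

(** * Eigenfunctions of a metric graph and the second eigenvalue *)

Section Graph.
Context {R : realType} (G : metric_graph R).
Implicit Types (f : graph_fun G) (mu : R).

Lemma on_edge0 (e : edge G) : 0 \in on_edge e.
Proof. by rewrite in_itv/= lexx ltW// len_gt0. Qed.

Lemma on_edge_len (e : edge G) : len e \in on_edge e.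
Proof. by rewrite in_itv/= lexx ltW// len_gt0. Qed.

(** Grouping the edge ends by vertex gives [psi v] times Kirchhoff's condition at [v]. With the
    vertex values of [f] as [psi], this says that the flux increments sum to zero. *)
Lemma weak_kirchhoff f (psi : vertex G -> R) : kirchhoff f ->
  \sum_e (psi (src e) * derive1 (f e) 0 - psi (tgt e) * derive1 (f e) (len e))
    = 0.
Proof.
move=> kf; rewrite big_split/= sumrN.
rewrite (partition_big (@src R G) xpredT)//=.
rewrite (partition_big (@tgt R G) xpredT)//= -sumrB big1// => v _.
rewrite (eq_bigr (fun e => psi v * derive1 (f e) 0)); last by move=> e /eqP ->.
rewrite [X in _ - X](eq_bigr (fun e => psi v * derive1 (f e) (len e))).
  by rewrite -!mulr_sumr -mulrBr kf mulr0.
by move=> e /eqP ->.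
Qed.

Lemma eigenfunction_nonpos f mu e x : mu <= 0 -> laplacian_eigenspace mu f ->
  x \in on_edge e -> f e x = f e 0.
Proof.
move=> mu0 [fs [phi fphi] kf].
have flux e' := solution_flux (ltW (len_gt0 e')) mu0 (fs e').
have sum0 : \sum_e (f e (len e) * derive1 (f e) (len e) -
    f e 0 * derive1 (f e) 0) = 0.
  have := weak_kirchhoff phi kf; move/(congr1 -%R); rewrite oppr0 -sumrN.
  by apply: etrans; apply: eq_bigr => e' _; have [-> ->] := fphi e'; rewrite opprB.
apply: (flux e).2; apply/esym/subr0_eq.
by apply: (psumr_eq0P _ sum0) => // e' _; rewrite subr_ge0 (flux e').1.
Qed.

(** Connectedness through locally constant functions, restricted to the vertices that carry an edge:
    these are the ones seen by functions on the edges. *)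
Definition edge_connected :=
  forall phi : vertex G -> R, (forall e, phi (src e) = phi (tgt e)) ->
  exists c, forall e, phi (src e) = c.

Lemma eigenfunction_nonpos_cst f mu : edge_connected -> mu <= 0 ->
  laplacian_eigenspace mu f ->
  exists c, forall e x, x \in on_edge e -> f e x = c.
Proof.
move=> Gc mu0 Ef; have [_ [phi fphi] _] := Ef.
have [|c phic] := Gc phi.
  move=> e; have [<- <-] := fphi e; apply/esym/(eigenfunction_nonpos mu0 Ef).
  by rewrite in_itv/= lexx ltW// len_gt0.
by exists c => e x /(eigenfunction_nonpos mu0 Ef) ->; rewrite -(phic e) (fphi e).1.
Qed.

Lemma constant_eigenfunction : laplacian_eigenspace 0 (fun (e : edge G) => cst (1 : R)).
Proof.
have d0 : derive1 (cst (1 : R)) = cst 0 by apply/funext => x; exact: derive1_cst.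
split.
- by move=> e x _; rewrite !d0 derive1_cst oppr0 mul0r; split=> //; exact: derivable_cst.
- by exists (fun=> 1).
- by move=> v; rewrite d0 !big1// subrr.
Qed.

Lemma lambdaN_eq k mu : is_kth_eigenvalue G k mu -> lambdaN G k = mu.
Proof.
move=> h; rewrite /lambdaN; case: xgetP => [nu _ hnu|/(_ mu)//].
exact: is_kth_eigenvalue_inj hnu h.
Qed.

(** The constant and the nonconstant [f] give two independent eigenfunctions up to [mu]. Every
    eigenfunction below [mu] is a constant, possibly 0, so two of them are dependent. *)
Lemma lambda2_eq f mu e e' x x' : edge_connected -> 0 < mu ->
  laplacian_eigenspace mu f ->
  x \in on_edge e -> x' \in on_edge e' -> f e x != f e' x' ->
  (forall (nu : R) (g : graph_fun G), 0 < nu -> nu < mu ->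
    laplacian_eigenspace nu g -> forall e x, x \in on_edge e -> g e x = 0) ->
  lambdaN G 2 = mu.
Proof.
move=> Gc mu0 Ef xe xe' fne low; apply: lambdaN_eq; split.
  exists (fun i : 'I_2 => if i == ord0 then 0 else mu).
  exists (fun i : 'I_2 => if i == ord0 then fun=> cst 1 else f); split.
    move=> i; case: ifP => _; last by split=> /=.
    by split=> /=; [exact: ltW|exact: constant_eigenfunction].
  move=> c; rewrite /linearly_independent => h.
  have h' d y : y \in on_edge d -> c ord0 + c (lift ord0 ord0) * f d y = 0.
    by move=> /h; rewrite !big_ord_recl big_ord0/= mulr1 addr0.
  have c1 : c (lift ord0 ord0) = 0.
    apply/eqP; have : c (lift ord0 ord0) * (f e x - f e' x') = 0.
      by have := h' _ _ xe; have := h' _ _ xe'; lra.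
    by move=> /eqP; rewrite mulf_eq0 subr_eq0 (negbTE fne) orbF.
  have c0 : c ord0 = 0 by have := h' _ _ xe; rewrite c1 mul0r addr0.
  move=> i; case: (unliftP ord0 i) => [j ->|->//].
  by rewrite (_ : j = ord0)//; apply/val_inj; case: j => [[]].
move=> [nu [g [Eg gfree]]].
have gcst i : exists d, forall e x, x \in on_edge e -> g i e x = d.
  have [/= nulow Egi] := Eg i; have [nu0|nu0] := leP (nu i) 0.
    exact: eigenfunction_nonpos_cst Egi.
  by exists 0 => *; apply: (low (nu i)).
have [d0 gd0] := gcst ord0; have [d1 gd1] := gcst (lift ord0 ord0).
(* The coefficients [(d1, - d0)] annihilate the two constants, which forces [d1 = 0]; then [(0, 1)]
   is a nontrivial relation. *)
have dd0 : d1 = 0.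
  have := gfree (fun i => if i == ord0 then d1 else - d0) _ ord0; apply.
  move=> d y yd; rewrite !big_ord_recl big_ord0/= gd0// gd1//; ring.
pose c (i : 'I_2) : R := if i == ord0 then 0 else 1.
have /eqP : c (lift ord0 ord0) = 0.
  apply: gfree => d y yd.
  by rewrite !big_ord_recl big_ord0 /c/= gd1// dd0; ring.
by rewrite /c/= oner_eq0.
Qed.

End Graph.

(** * Eigenfunctions across the contraction of edges *)

Section ContractionEigenspace.
Context {R : realType} {V E : finType} (s t : E -> V) (l : E -> R).
Implicit Types (F : E -> R -> R) (Phi Psi : V -> R) (mu : R).
Let G := contract_edges s t l.

Definition contraction_invariant Psi := forall e, l e <= 0 -> Psi (s e) = Psi (t e).

(* The eigenvalue problem of the contracted graph in terms of the uncontracted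
   one; Kirchhoff's conditions are tested against functions on the vertices. *)
Definition contracted_eigenspace mu F Phi :=
  [/\ forall e, 0 < l e -> forall x, x \in `[0, l e] ->
        [/\ derivable (F e) x 1, derivable (derive1 (F e)) x 1
          & - derive1 (derive1 (F e)) x = mu * F e x],
      forall e, 0 < l e -> F e 0 = Phi (s e) /\ F e (l e) = Phi (t e),
      contraction_invariant Phi &
      forall Psi, contraction_invariant Psi ->
        \sum_(e | 0 < l e)
          (Psi (s e) * derive1 (F e) 0 - Psi (t e) * derive1 (F e) (l e)) = 0].

Lemma vertex_class_contracted e : l e <= 0 ->
  vertex_class s t l (s e) = vertex_class s t l (t e).
Proof.
move=> le0; apply: val_inj => /=; apply/(fingraph.rootP (contracted_sym s t l)).
by apply: connect1; apply/existsP; exists e; rewrite le0 !eqxx.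
Qed.

Lemma contraction_invariant_root Psi v : contraction_invariant Psi ->
  Psi (val (vertex_class s t l v)) = Psi v.
Proof.
move=> inv; have /connectP[p] := connect_root (contracted_adj s t l) v.
rewrite /= => pth ->; elim: p v pth => //= w p IHp v /andP[vw /IHp ->].
by have /existsP[e /andP[/inv e0 /orP[/andP[/eqP<- /eqP<-]|/andP[/eqP<- /eqP<-]]]] := vw.
Qed.

Definition extend_contraction (f : graph_fun G) : E -> R -> R :=
  fun e => if insub e is Some e' then f e' else cst 0.

Lemma extend_contractionE f (e : edge G) : extend_contraction f (val e) = f e.
Proof. by rewrite /extend_contraction valK. Qed.

Lemma sum_contraction_edge (h : E -> R) :
  \sum_(e | 0 < l e) h e = \sum_(e : edge G) h (val e).
Proof. exact: (big_sub (fun e => 0 < l e) h). Qed.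

Lemma eigenspace_extend mu (f : graph_fun G) : laplacian_eigenspace mu f ->
  exists Phi, contracted_eigenspace mu (extend_contraction f) Phi.
Proof.
move=> [fs [phi fphi] kf]; exists (fun v => phi (vertex_class s t l v)); split.
- move=> e le x xe; pose e' : edge G := exist _ e le.
  by rewrite -[e]/(val e') extend_contractionE; exact: (fs e').
- move=> e le; pose e' : edge G := exist _ e le.
  by rewrite -[e]/(val e') extend_contractionE; exact: (fphi e').
- by move=> e /vertex_class_contracted ->.
- move=> Psi inv; rewrite sum_contraction_edge.
  have := @weak_kirchhoff R G f (fun u : contraction_vertex s t l => Psi (val u)) kf.
  apply: etrans.
  apply: eq_bigr => e _; rewrite extend_contractionE.
  by rewrite !contraction_invariant_root.
Qed.

Lemma eigenspace_restrict mu F Phi : contracted_eigenspace mu F Phi ->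
  laplacian_eigenspace mu ((fun e => F (val e)) : graph_fun G).
Proof.
move=> [fs fphi inv kf]; split.
- by move=> [e le] x xe; exact: fs.
- exists (fun u : contraction_vertex s t l => Phi (val u)) => -[e le].
  by rewrite /= !(contraction_invariant_root _ inv); exact: fphi.
(* The indicator of a contraction class, as test function, isolates Kirchhoff's condition at the
   contracted vertex [u]. *)
- move=> u; pose Psi v : R := (vertex_class s t l v == u)%:R.
  have invPsi : contraction_invariant Psi.
    by move=> e /vertex_class_contracted; rewrite /Psi => ->.
  have := kf Psi invPsi; rewrite sum_contraction_edge; apply: etrans.
  rewrite sumrB; congr (_ - _); rewrite big_mkcond/=; apply: eq_bigr => e _.
    by rewrite /Psi; case: ifP; rewrite ?mul1r ?mul0r.
  by rewrite /Psi; case: ifP; rewrite ?mul1r ?mul0r.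
Qed.

Lemma contraction_connected :
  (forall Phi, (forall e, Phi (s e) = Phi (t e)) -> exists c, forall v, Phi v = c) ->
  edge_connected G.
Proof.
move=> conn phi phiE.
have [e|c phic] := conn (fun v => phi (vertex_class s t l v)).
  have [le|/vertex_class_contracted->//] := ltP 0 (l e).
  exact: (phiE (exist _ e le)).
by exists c => e; exact: phic.
Qed.

End ContractionEigenspace.

(** * Pumpkins on a stick *)

(* [a] and [b] are the amplitudes of the waves on the parallel edges and on the
   stick at [v_+], with angles [x] and [y] measured towards each other at [v_2]. *)
Section Matching.
Context {R : realType}.
Implicit Types a b x y : R.

Lemma polar_eq0 a x : a * cos x = 0 -> a * sin x = 0 -> a = 0.
Proof.
move=> c s; have : a * cos x * cos x + a * sin x * sin x = 0.
  by rewrite c s !mul0r addr0.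
by rewrite -!mulrA -!expr2 -mulrDr cos2Dsin2 mulr1.
Qed.

Lemma matching_eq0 a b x y : 0 < x + y < pi ->
  a * cos x = b * cos y -> a * sin x = - (b * sin y) -> a = 0 /\ b = 0.
Proof.
move=> xy c s; have : a * sin (x + y) = 0.
  rewrite sinD mulrDr !mulrA s c; ring.
have sxy : sin (x + y) != 0 by rewrite lt0r_neq0// sin_gt0_pi.
move=> /eqP; rewrite mulf_eq0 (negbTE sxy) orbF => /eqP a0; split=> //.
by move: c s; rewrite a0 !mul0r => /esym c /esym/eqP; rewrite oppr_eq0 => /eqP; exact: polar_eq0 c.
Qed.

(** The determinant [sin (x + y)] of the system now vanishes, and its kernel is the line
    [b = - a]. *)
Lemma matching_pi a b x y : x + y = pi ->
  a * cos x = b * cos y -> a * sin x = - (b * sin y) -> b = - a.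
Proof.
move=> xy; have -> : x = pi - y by rewrite -xy addrK.
rewrite cosB sinB cospi sinpi !mul0r !mulN1r addr0 add0r opprK => c s.
have : b + a = 0 by apply: (@polar_eq0 _ y); lra.
lra.
Qed.

End Matching.

(** * Eigenfunctions and second eigenvalue of the pumpkin on a stick *)

Section Tails.
Context {R : realType}.
Variables (L l1 : R) (m : nat) (l2 : R).
Hypotheses (L_gt0 : 0 < L) (m_gt1 : (2 <= m)%N) (T : triangle L (l1, l2)).

Let M : R := m%:R.
Let d := (L - l1 - l2) / M.
Local Notation amp := (amplitude M).
Local Notation ph := (phase M).

Let M_gt1 : 1 < M. Proof. by rewrite /M ltr1n. Qed.
Let M_gt0 : 0 < M. Proof. exact: lt_trans ltr01 M_gt1. Qed.
Let l1_ge0 : 0 <= l1. Proof. by case: T. Qed.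
Let l2_ge0 : 0 <= l2. Proof. by case: T. Qed.
Let d_ge0 : 0 <= d.
Proof. by case: T => /= ? ? ?; rewrite divr_ge0 ?(ltW M_gt0)//; lra. Qed.

Lemma sum_ps_edge (h : ps_edge m -> R) :
  \sum_(e | 0 < ps_len L l1 l2 e) h e =
  (if 0 < l1 then h (inl false) else 0) + (if 0 < l2 then h (inl true) else 0) +
  \sum_(i < m) (if 0 < d then h (inr i) else 0).
Proof.
rewrite big_mkcond big_sumType big_bool/= [X in X + _]addrC.
by congr (_ + _).
Qed.

Lemma ps_connected : edge_connected (pumpkin_stick L l1 m l2).
Proof.
apply: contraction_connected => Phi PhiE; exists (Phi v_1).
have i0 : 'I_m by apply: (@Ordinal m 0); rewrite (leq_trans _ m_gt1).
case=> [[|[|[|[|//]]]] p].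
- by rewrite -(PhiE (inl false)); congr Phi; exact: val_inj.
- by congr Phi; exact: val_inj.
- by rewrite (PhiE (inr i0)); congr Phi; exact: val_inj.
- transitivity (Phi v_2); last by rewrite (PhiE (inr i0)).
  by rewrite (PhiE (inl true)); congr Phi; exact: val_inj.
Qed.

(** The sticks carry angle 0 at [v_minus] and [v_plus], where the slope must vanish. The factor
    [M / amp] makes a stick agree in value with the parallel edges at their common vertex while
    having [M] times the slope of one of them ([amp_cos], [amp_sin]). *)
Definition ps_wave k a b (e : ps_edge m) : R -> R :=
  match e with
  | inl false => wave (a * (M / amp (k * l1))) k 0
  | inr _ => wave a k (ph (k * l1))
  | inl true => wave (b * (M / amp (k * l2))) k (- (k * l2))
  end.

Lemma amp_cos x : M / amp x * cos x = cos (ph x).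
Proof.
have [e _] := amplitude_phase x M_gt0; have a0 := lt0r_neq0 (amplitude_gt0 x M_gt0).
by rewrite mulrAC -e mulrAC mulfV// mul1r.
Qed.

Lemma amp_sin x : M / amp x * sin x = M * sin (ph x).
Proof.
have [_ e] := amplitude_phase x M_gt0; have a0 := lt0r_neq0 (amplitude_gt0 x M_gt0).
by rewrite mulrAC -e; field.
Qed.

(** For [k * d < pi] a solution on a parallel edge is determined by its two end values, so all
    parallel edges carry the same function. The sticks are determined by their vanishing slope at
    the outer end, and two amplitudes remain, tied by continuity and Kirchhoff's condition at
    [v_2]. *)
Lemma ps_eigenfunction k F Phi : 0 < k -> k * d < pi ->
  contracted_eigenspace (@ps_src m) (@ps_tgt m) (ps_len L l1 l2) (k ^+ 2) F Phi ->
  exists a b,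
    [/\ forall e, 0 < ps_len L l1 l2 e -> forall x, x \in `[0, ps_len L l1 l2 e] ->
          F e x = ps_wave k a b e x,
        a * cos (k * d + ph (k * l1)) = b * cos (ph (k * l2)) &
        a * sin (k * d + ph (k * l1)) = - (b * sin (ph (k * l2)))].
Proof.
move=> k0 kd [Fs Fphi inv kir]; have kn0 := lt0r_neq0 k0.
have mn0 := lt0r_neq0 M_gt0.
have a1 := lt0r_neq0 (amplitude_gt0 (k * l1) M_gt0).
have a2 := lt0r_neq0 (amplitude_gt0 (k * l2) M_gt0).
have i0 : 'I_m by apply: (@Ordinal m 0); rewrite (leq_trans _ m_gt1).
(* End slopes, set to 0 on contracted edges so that Kirchhoff sums run over all edges. *)
pose P0 e := if 0 < ps_len L l1 l2 e then derive1 (F e) 0 else 0.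
pose P1 e := if 0 < ps_len L l1 l2 e then derive1 (F e) (ps_len L l1 l2 e) else 0.
have kirP Psi : contraction_invariant (@ps_src m) (@ps_tgt m) (ps_len L l1 l2) Psi ->
    Psi v_minus * P0 (inl false) - Psi v_1 * P1 (inl false) +
    (Psi v_2 * P0 (inl true) - Psi v_plus * P1 (inl true)) +
    \sum_(i < m) (Psi v_1 * P0 (inr i) - Psi v_2 * P1 (inr i)) = 0.
  move=> /kir; rewrite sum_ps_edge; apply: etrans; rewrite /P0 /P1 /=.
  congr (_ + _ + _); last apply: eq_bigr => i _.
  - by case: ifP; rewrite ?mulr0 ?subr0.
  - by case: ifP; rewrite ?mulr0 ?subr0.
  - by rewrite -/d; case: ifP; rewrite ?mulr0 ?subr0.
have P0l : P0 (inl false) = 0.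
  have [l10|l10] := ltP 0 l1; last by rewrite /P0 /= ltNge l10.
  have := kirP (fun v => (v == v_minus)%:R).
  rewrite big1 => [|i _]; last by rewrite /= !mul0r subrr.
  rewrite /= !mul0r mul1r !subr0 !addr0; apply.
  by case=> [[]|i]//=; rewrite leNgt l10.
have P1r : P1 (inl true) = 0.
  have [l20|l20] := ltP 0 l2; last by rewrite /P1 /= ltNge l20.
  have := kirP (fun v => (v == v_plus)%:R).
  rewrite big1 => [|i _]; last by rewrite /= !mul0r subrr.
  rewrite /= !mul0r mul1r !addr0 !subr0 add0r sub0r => h.
  apply: oppr_inj; rewrite oppr0; apply: h.
  by case=> [[]|i]//=; rewrite leNgt l20.
pose a := Phi v_minus * amp (k * l1) / M.
pose b := Phi v_plus * amp (k * l2) / M.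
have aE : a * (M / amp (k * l1)) = Phi v_minus by rewrite /a; field; rewrite mn0 a1.
have bE : b * (M / amp (k * l2)) = Phi v_plus by rewrite /b; field; rewrite mn0 a2.
have [Phi1 P1l Fl] : [/\ Phi v_1 = a * cos (ph (k * l1)),
    P1 (inl false) = - (k * M * (a * sin (ph (k * l1)))) &
    0 < l1 -> forall x, x \in `[0, l1] -> F (inl false) x = ps_wave k a b (inl false) x].
  rewrite -amp_cos mulrA aE.
  rewrite (_ : k * M * _ = k * (Phi v_minus * sin (k * l1))); last first.
    by rewrite -aE -(mulrA a) amp_sin; ring.
  have [l10|l10] := ltP 0 l1; last first.
    have l1E : l1 = 0 by apply/eqP; rewrite eq_le l10 l1_ge0.
    split; [|rewrite /P1/= ltNge l10 l1E mulr0 sin0; ring|by []].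
    by rewrite l1E mulr0 cos0 mulr1; apply/esym/(inv (inl false)).
  have s0 : 0 \in `[0, l1] by rewrite in_itv/= lexx.
  have s1 : l1 \in `[0, l1] by rewrite in_itv/= lexx ltW.
  have [/= F0 F1] := Fphi (inl false) l10.
  have d0 : derive1 (F (inl false)) 0 = 0 by move: P0l; rewrite /P0/= l10.
  have sol x := @solution_on_edge R _ k 0 l1 0 x kn0 (Fs (inl false) l10) s0.
  have [e1 e2] := sol _ s1; rewrite /P1/= l10; split.
  - by rewrite -F1 e1 d0 F0 subr0; ring.
  - by rewrite e2 d0 F0 subr0; ring.
  - by move=> _ x /sol[-> _]; rewrite /wave aE d0 F0 subr0 addr0; ring.
have [Phi2 P0r Fr] : [/\ Phi v_2 = b * cos (ph (k * l2)),
    P0 (inl true) = k * M * (b * sin (ph (k * l2))) &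
    0 < l2 -> forall x, x \in `[0, l2] -> F (inl true) x = ps_wave k a b (inl true) x].
  rewrite -amp_cos mulrA bE.
  rewrite (_ : k * M * _ = k * (Phi v_plus * sin (k * l2))); last first.
    by rewrite -bE -(mulrA b) amp_sin; ring.
  have [l20|l20] := ltP 0 l2; last first.
    have l2E : l2 = 0 by apply/eqP; rewrite eq_le l20 l2_ge0.
    split; [|rewrite /P0/= ltNge l20 l2E mulr0 sin0; ring|by []].
    by rewrite l2E mulr0 cos0 mulr1; exact: (inv (inl true)).
  have s0 : 0 \in `[0, l2] by rewrite in_itv/= lexx ltW.
  have s1 : l2 \in `[0, l2] by rewrite in_itv/= lexx ltW.
  have [/= F0 F1] := Fphi (inl true) l20.
  have d1 : derive1 (F (inl true)) l2 = 0 by move: P1r; rewrite /P1/= l20.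
  have sol x := @solution_on_edge R _ k 0 l2 l2 x kn0 (Fs (inl true) l20) s1.
  have [e1 e2] := sol _ s0; rewrite /P0/= l20; split.
  - by rewrite -F0 e1 d1 F1 sub0r mulrN cosN; ring.
  - by rewrite e2 d1 F1 sub0r mulrN sinN; ring.
  - by move=> _ x /sol[-> _]; rewrite /wave bE d1 F1 mul0r mul0r addr0 mulrBr.
set al := ph (k * l1) in Phi1 P1l *; set be := ph (k * l2) in Phi2 P0r *.
(* For [d = 0] the vertices [v_1] and [v_2] coincide: continuity gives the cosine equation, the
   constant test function the sine equation. *)
exists a, b; have [d0|d0] := ltP 0 d; last first.
  have dE : d = 0 by apply/eqP; rewrite eq_le d0 d_ge0.
  split.
  - by case=> [[]|i] //; rewrite /= -/d ltNge d0.
  - rewrite dE mulr0 add0r -Phi1 -Phi2; apply: (inv (inr i0)).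
    by rewrite /= -/d.
  - rewrite dE mulr0 add0r; have := kirP (fun=> 1) (fun _ _ => erefl).
    rewrite big1 => [|i _]; last by rewrite /P0 /P1 /= -/d ltNge d0 !mulr0 subrr.
    rewrite P0l P1r P1l P0r => e.
    apply: (mulfI (lt0r_neq0 (mulr_gt0 k0 M_gt0))); lra.
have s0 : 0 \in `[0, d] by rewrite in_itv/= lexx ltW.
have s1 : d \in `[0, d] by rewrite in_itv/= lexx ltW.
have skd : sin (k * d) != 0 by rewrite lt0r_neq0// sin_gt0_pi// mulr_gt0.
have sol i x := @solution_on_edge R _ k 0 d 0 x kn0 (Fs (inr i) d0) s0.
pose q := (Phi v_2 - Phi v_1 * cos (k * d)) / sin (k * d) * k.
have P0m i : derive1 (F (inr i)) 0 = q.
  have [/= F0 F1] := Fphi (inr i) d0.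
  have [e1 _] := sol i _ s1; rewrite /q -F1 -F0 e1 subr0.
  by field; rewrite skd kn0.
have P1m i : derive1 (F (inr i)) d = - (k * Phi v_1 * sin (k * d)) + q * cos (k * d).
  have [/= F0 F1] := Fphi (inr i) d0.
  by have [_ ->] := sol i _ s1; rewrite P0m F0 subr0.
(* The indicator of [v_minus] and [v_1] together remains admissible when the first stick is
   contracted. *)
have qE : q = - (k * (a * sin al)).
  have := kirP (fun v => ((v == v_minus) || (v == v_1))%:R).
  rewrite (eq_bigr (fun=> q)) => [|i _]; last first.
    by rewrite /P0 /P1 /= -/d d0 P0m mul1r mul0r subr0.
  rewrite sumr_const card_ord -mulr_natl P0l P1l /= => h.
  apply: (mulfI mn0); apply/eqP; rewrite -subr_eq0; apply/eqP.
  rewrite -[RHS]h; first by rewrite /M; ring.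
  by case=> [[]|i]//=; rewrite -/d leNgt d0.
have qdE : - (k * Phi v_1 * sin (k * d)) + q * cos (k * d) = k * (b * sin be).
  set qd := LHS.
  have := kirP (fun v => ((v == v_plus) || (v == v_2))%:R).
  rewrite (eq_bigr (fun=> - qd)) => [|i _]; last first.
    by rewrite /P0 /P1 /= -/d d0 P1m mul1r mul0r sub0r.
  rewrite sumr_const card_ord -mulr_natl P1r P0r /= => h.
  apply: (mulfI mn0); apply/esym/eqP; rewrite -subr_eq0; apply/eqP.
  rewrite -[RHS]h; first by rewrite /M; ring.
  by case=> [[]|i]//=; rewrite -/d leNgt d0.
split.
- case=> [[] le x xe|i _ x xe]; [exact: Fr|exact: Fl|].
  have [-> _] := sol i _ xe; have [/= F0 _] := Fphi (inr i) d0.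
  rewrite F0 P0m qE Phi1 subr0 /= /wave -/al (cosD (k * x)); field.
  exact: kn0.
- have [/= F0 F1] := Fphi (inr i0) d0.
  have [e1 _] := sol i0 _ s1; rewrite -Phi2 -F1 e1 F0 P0m qE Phi1 subr0 (cosD (k * d)); field.
  exact: kn0.
- apply: (mulfI kn0); rewrite mulrN -qdE qE Phi1 (sinD (k * d)); ring.
Qed.

Lemma resonant_mid k : resonant L l1 M l2 k -> k * d + ph (k * l1) = pi - ph (k * l2).
Proof. by case=> _; rewrite /phase_sum -/d => <-; rewrite addrK. Qed.

Lemma ps_eigenspace_trivial k F Phi : 0 < k -> phase_sum L l1 M l2 k < pi ->
  contracted_eigenspace (@ps_src m) (@ps_tgt m) (ps_len L l1 l2) (k ^+ 2) F Phi ->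
  forall e, 0 < ps_len L l1 l2 e -> forall x, x \in `[0, ps_len L l1 l2 e] -> F e x = 0.
Proof.
move=> k0 kpi EF; have p0 : 0 < phase_sum L l1 M l2 k.
  by rewrite -(phase_sum0 L l1 M l2) phase_sum_lt.
have p1 : 0 <= ph (k * l1) by rewrite phase_ge0// mulr_ge0// ltW.
have p2 : 0 <= ph (k * l2) by rewrite phase_ge0// mulr_ge0// ltW.
have kd : k * d < pi by move: kpi; rewrite /phase_sum -/d; lra.
have [a [b [FE c s]]] := ps_eigenfunction k0 kd EF.
have [|a0 b0] := matching_eq0 _ c s; first by apply/andP; split.
move=> e le x xe; rewrite FE// a0 b0.
by case: e {le xe} => [[]|i]; rewrite /= /wave !mul0r.
Qed.

(** A stick of positive length takes a share of the phase [pi] and leaves [k * d < pi]. For the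
    pumpkin [k * d = pi], and functions vanishing at both vertices enlarge the eigenspace. *)
Lemma ps_eigenspace_resonant k F Phi : resonant L l1 M l2 k -> l1 + l2 != 0 ->
  contracted_eigenspace (@ps_src m) (@ps_tgt m) (ps_len L l1 l2) (k ^+ 2) F Phi ->
  exists a, forall e, 0 < ps_len L l1 l2 e -> forall x, x \in `[0, ps_len L l1 l2 e] ->
    F e x = ps_wave k a (- a) e x.
Proof.
move=> r l0 EF; have [k0 kE] := r.
have [_ p1 p2 _ _] := resonant_phase_le M_gt0 T r.
have kd : k * d < pi.
  have [lt1|le1] := ltP 0 l1.
    have : ph 0 < ph (k * l1) by apply: phase_incr => //; rewrite mulr_gt0.
    by rewrite phase0; move: kE; rewrite /phase_sum -/d; lra.
  have lt2 : 0 < l2 by move/eqP: l0; have := l1_ge0; have := l2_ge0; lra.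
  have : ph 0 < ph (k * l2) by apply: phase_incr => //; rewrite mulr_gt0.
  by rewrite phase0; move: kE; rewrite /phase_sum -/d; lra.
have [a [b [FE c s]]] := ps_eigenfunction k0 kd EF.
by exists a; rewrite -(matching_pi _ c s).
Qed.

Lemma ps_wave_eigenspace k : resonant L l1 M l2 k ->
  exists Phi, contracted_eigenspace (@ps_src m) (@ps_tgt m) (ps_len L l1 l2)
    (k ^+ 2) (ps_wave k 1 (- 1)) Phi.
Proof.
move=> r; have mid := resonant_mid r; have [k0 _] := r.
pose Phi (v : 'I_4) : R := match val v with
  | 0 => M / amp (k * l1) | 1 => cos (ph (k * l1))
  | 2 => - cos (ph (k * l2)) | _ => - (M / amp (k * l2)) end.
exists Phi; split.
- by move=> [[]|i] _ x _; exact: wave_solves.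
- case=> [[]|i] _; rewrite /= /wave /Phi/= -/d.
  + rewrite mulr0 add0r cosN subrr cos0 -amp_cos; split; ring.
  + rewrite mulr0 addr0 cos0 addr0 -amp_cos; split; ring.
  + rewrite mid mulr0 add0r !mul1r cosB cospi sinpi; split=> //; ring.
- case=> [[]|i]/=; rewrite /Phi/= => h.
  + have -> : l2 = 0 by apply/eqP; rewrite eq_le h l2_ge0.
    by rewrite mulr0 -amp_cos cos0 mulr1.
  + have -> : l1 = 0 by apply/eqP; rewrite eq_le h l1_ge0.
    by rewrite mulr0 -amp_cos cos0 mulr1.
  + have d0 : d = 0 by apply/eqP; rewrite eq_le h d_ge0.
    by move: mid; rewrite d0 mulr0 add0r => ->; rewrite cosB cospi sinpi; ring.
- move=> Psi inv; rewrite sum_ps_edge /= !derive1_wave -/d.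
  (* A contracted stick contributes 0, which is also the value of the closed form at length 0. *)
  set A := (if 0 < l1 then _ else 0).
  have -> : A = Psi v_1 * (k * M * sin (ph (k * l1))).
    rewrite /A; case: ifPn => [_|]; last first.
      rewrite -leNgt => h; have -> : l1 = 0 by apply/eqP; rewrite eq_le h l1_ge0.
      by rewrite mulr0 phase0 sin0 !mulr0.
    by rewrite -(mulrA k M) -amp_sin mulr0 !addr0 sin0; ring.
  set B := (if 0 < l2 then _ else 0).
  have -> : B = - (Psi v_2 * (k * M * sin (ph (k * l2)))).
    rewrite /B; case: ifPn => [_|]; last first.
      rewrite -leNgt => h; have -> : l2 = 0 by apply/eqP; rewrite eq_le h l2_ge0.
      by rewrite mulr0 phase0 sin0 !mulr0 oppr0.
    by rewrite -(mulrA k M) -amp_sin mulr0 add0r subrr sin0 sinN; ring.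
  rewrite sumr_const card_ord -mulr_natl -/M.
  have smid : sin (k * d + ph (k * l1)) = sin (ph (k * l2)).
    by rewrite mid sinB cospi sinpi; ring.
  case: ifPn => [_|]; first by rewrite mulr0 add0r smid; ring.
  rewrite -leNgt => h; have d0 : d = 0 by apply/eqP; rewrite eq_le h d_ge0.
  have i0 : 'I_m by apply: (@Ordinal m 0); rewrite (leq_trans _ m_gt1).
  move: smid; rewrite d0 mulr0 add0r => ->.
  have -> : Psi v_1 = Psi v_2 by exact: (inv (inr i0)).
  ring.
Qed.


Lemma ps_waveZ k a e x : ps_wave k a (- a) e x = a * ps_wave k 1 (- 1) e x.
Proof. by case: e => [[]|i]; rewrite /= /wave; ring. Qed.

(** On the first stick and the parallel edges the angle runs inside [[0, pi]], where [cos]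
    decreases; on the last stick inside [[- pi, 0]], where it increases but has a negative
    coefficient. *)
Lemma ps_wave_decr k e : resonant L l1 M l2 k ->
  {in `[0, ps_len L l1 l2 e] &, {homo ps_wave k 1 (- 1) e : x y / x < y >-> y < x}}.
Proof.
move=> r x y; rewrite !in_itv/= => /andP[x0 xl] /andP[y0 yl] xy.
have [d0 p1 p2 kl1 kl2] := resonant_phase_le M_gt0 T r.
have mid := resonant_mid r; have [k0 _] := r.
have kx0 : 0 <= k * x by rewrite mulr_ge0// ltW.
have ky0 : 0 <= k * y by rewrite mulr_ge0// ltW.
have kxy : k * x < k * y by rewrite ltr_pM2l.
have amp0 z : 0 < M / amp z by rewrite divr_gt0// amplitude_gt0.
have cos_lt u v : 0 <= u -> v <= pi -> u < v -> cos v < cos u.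
  move=> u0 vpi uv; rewrite ltr_cos// in_itv/= ?u0 ?vpi ?andbT.
    exact: le_trans (ltW uv) vpi.
  exact: le_trans u0 (ltW uv).
have kyl : k * y <= k * ps_len L l1 l2 e by rewrite ler_pM2l.
case: e {xl yl} kyl => [[]|i] /= kyl; rewrite /wave.
- rewrite mulN1r !mulNr ltrN2 ltr_pM2l// -(cosN (k * y - _)) -(cosN (k * x - _)) !opprB.
  by apply: cos_lt; lra.
- by rewrite !mul1r !addr0 ltr_pM2l//; apply: cos_lt => //; lra.
- by rewrite -/d in kyl; rewrite !mul1r; apply: cos_lt; lra.
Qed.

Let G := pumpkin_stick L l1 m l2.

Lemma ps_edge_exists : exists e : ps_edge m, 0 < ps_len L l1 l2 e.
Proof.
have i0 : 'I_m by apply: (@Ordinal m 0); rewrite (leq_trans _ m_gt1).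
have [l10|l10] := ltP 0 l1; first by exists (inl false).
have [l20|l20] := ltP 0 l2; first by exists (inl true).
by exists (inr i0); rewrite /= divr_gt0//; have := L_gt0; lra.
Qed.

Lemma ps_wave_neq k : resonant L l1 M l2 k ->
  exists e : edge G, ps_wave k 1 (- 1) (val e) (len e) != ps_wave k 1 (- 1) (val e) 0.
Proof.
move=> r; have [e le] := ps_edge_exists; exists (exist _ e le).
by rewrite lt_eqF// ps_wave_decr// in_itv/= lexx ltW.
Qed.

Lemma lambda2_psE k : resonant L l1 M l2 k -> lambda2_ps L l1 m l2 = k ^+ 2.
Proof.
move=> r; have [k0 kE] := r; have [Phi /eigenspace_restrict Ew] := ps_wave_eigenspace r.
have [e we] := ps_wave_neq r.
have e0 := on_edge0 e.
have e1 := on_edge_len e.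
apply: (lambda2_eq ps_connected _ Ew e1 e0 we); first by rewrite exprn_gt0.
move=> nu g nu0 nuk; rewrite -[nu]sqr_sqrtr ?(ltW nu0)//.
move=> /eigenspace_extend[Psi Eg] e' x xe'.
rewrite -(extend_contractionE g); apply: (ps_eigenspace_trivial _ _ Eg) => //.
- by rewrite sqrtr_gt0.
- rewrite -kE phase_sum_lt// -(ltr_pXn2r (_ : 0 < 2)%N)//.
  + by rewrite sqr_sqrtr// ltW.
  + by rewrite nnegrE sqrtr_ge0.
  + by rewrite nnegrE ltW.
- exact: (len_gt0 e').
Qed.

Lemma ps_eigenspace_line k (f : graph_fun G) : resonant L l1 M l2 k -> l1 + l2 != 0 ->
  laplacian_eigenspace (k ^+ 2) f ->
  exists a, forall e x, x \in on_edge e -> f e x = a * ps_wave k 1 (- 1) (val e) x.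
Proof.
move=> r l0 /eigenspace_extend[Psi /(ps_eigenspace_resonant r l0)[a fE]].
exists a => e x xe; rewrite -ps_waveZ -fE//; last exact: (len_gt0 e).
by rewrite extend_contractionE.
Qed.

Lemma ps_monotonic k (f : graph_fun G) : resonant L l1 M l2 k -> l1 + l2 != 0 ->
  laplacian_eigenspace (k ^+ 2) f -> edgewise_monotonic f.
Proof.
move=> r l0 /(ps_eigenspace_line r l0)[a fE].
have wle (e : edge G) x y : x \in on_edge e -> y \in on_edge e -> x <= y ->
    ps_wave k 1 (- 1) (val e) y <= ps_wave k 1 (- 1) (val e) x.
  move=> xe ye; rewrite le_eqVlt => /predU1P[->//|xy]; apply: ltW.
  exact: ps_wave_decr.
have [a0|a0] := leP 0 a; [right|left] => e x y xe ye xy; rewrite !fE//.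
  by rewrite ler_wpM2l// wle.
by rewrite ler_nM2l// wle.
Qed.

Lemma ps_simple k : resonant L l1 M l2 k -> l1 + l2 != 0 ->
  simple_eigenvalue G (k ^+ 2).
Proof.
move=> r l0; have [Phi /eigenspace_restrict Ew] := ps_wave_eigenspace r.
have [e we] := ps_wave_neq r.
have e0 := on_edge0 e.
have e1 := on_edge_len e.
split.
  exists (fun=> k ^+ 2), (fun=> fun e : edge G => ps_wave k 1 (- 1) (val e)).
  split=> [i|c h i]; first by split.
  have c0 x : x \in on_edge e -> c ord0 * ps_wave k 1 (- 1) (val e) x = 0.
    by move=> /h; rewrite big_ord_recl big_ord0 addr0.
  rewrite (_ : i = ord0); last by apply/val_inj; case: i => [[]].
  apply/eqP; move: (c0 _ e0) (c0 _ e1) => /eqP; rewrite mulf_eq0 => /orP[//|/eqP w0].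
  by move=> /eqP; rewrite mulf_eq0 => /orP[//|/eqP w1]; rewrite w0 w1 eqxx in we.
move=> [mu [f [Ef free]]].
have line i : exists a, forall e x, x \in on_edge e ->
    f i e x = a * ps_wave k 1 (- 1) (val e) x.
  by have [-> /(ps_eigenspace_line r l0)] := Ef i.
have [a0 f0] := line ord0; have [a1 f1] := line (lift ord0 ord0).
have a10 : a1 = 0.
  apply: (free (fun i => if i == ord0 then a1 else - a0) _ ord0) => e2 y ye.
  by rewrite !big_ord_recl big_ord0/= f0// f1//; ring.
pose c (i : 'I_2) : R := if i == ord0 then 0 else 1.
have /eqP : c (lift ord0 ord0) = 0.
  apply: free => e2 y ye.
  by rewrite !big_ord_recl big_ord0 /c/= f1// a10; ring.
by rewrite /c/= oner_eq0.
Qed.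

End Tails.

(** * The tadpole *)

Section Tadpole.
Context {R : realType}.
Variables (L l : R).
Hypotheses (L_gt0 : 0 < L) (l_ge0 : 0 <= l) (l_le : l <= L).

(** Half the loop, written as the length of the parallel edges for [l1 = 0] and [m = 2]. The two
    graphs differ by a vertex of degree two at the midpoint of the loop, hence are distinct as
    combinatorial data; the tadpole is shown to obey the same resonance equation. *)
Let h := (L - 0 - l) / 2%:R.
Local Notation amp := (amplitude (2%:R : R)).
Local Notation ph := (phase (2%:R : R)).

Let T : triangle L (0, l). Proof. by split=> //=; rewrite add0r. Qed.
Let two_gt0 : 0 < 2%:R :> R. Proof. by []. Qed.
Let h_ge0 : 0 <= h.
Proof. by rewrite divr_ge0// subr0 subr_ge0. Qed.
Let hE : L - l = h + h.
Proof. by rewrite /h; field. Qed.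

Let tad_src (e : bool) := false.
Let tad_tgt (e : bool) := e.
Let tad_len (e : bool) := if e then l else L - l.

Lemma tadpole_connected : edge_connected (tadpole L l).
Proof.
apply: contraction_connected => Phi PhiE; exists (Phi false).
by case; rewrite // -(PhiE true).
Qed.

Definition tadpole_wave k a b (e : bool) : R -> R :=
  if e then wave (b * (2%:R / amp (k * l))) k (- (k * l)) else wave a k (- (k * h)).

Lemma tadpole_eigenfunction k F Phi : 0 < k -> k * h < pi ->
  contracted_eigenspace tad_src tad_tgt tad_len (k ^+ 2) F Phi ->
  exists a b,
    [/\ forall e, 0 < tad_len e -> forall x, x \in `[0, tad_len e] ->
          F e x = tadpole_wave k a b e x,
        a * cos (k * h) = b * cos (ph (k * l)) &
        a * sin (k * h) = - (b * sin (ph (k * l)))].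
Proof.
move=> k0 kh [Fs Fphi inv kir]; have kn0 := lt0r_neq0 k0.
have a2 := lt0r_neq0 (amplitude_gt0 (k * l) two_gt0).
pose P0 e := if 0 < tad_len e then derive1 (F e) 0 else 0.
pose P1 e := if 0 < tad_len e then derive1 (F e) (tad_len e) else 0.
have kirP Psi : contraction_invariant tad_src tad_tgt tad_len Psi ->
    (Psi false * P0 false - Psi false * P1 false) +
    (Psi false * P0 true - Psi true * P1 true) = 0.
  move=> /kir; rewrite big_mkcond big_bool/= [X in X = _]addrC; apply: etrans.
  by rewrite /P0 /P1 /=; congr (_ + _); case: ifP; rewrite ?mulr0 ?subr0.
have P1t : P1 true = 0.
  have [l0|l0] := ltP 0 l; last by rewrite /P1 /= ltNge l0.
  have := kirP (fun v => v%:R).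
  rewrite /= !mul0r !sub0r mul1r oppr0 add0r => e.
  apply: oppr_inj; rewrite oppr0; apply: e.
  by case=> //=; rewrite leNgt l0.
have kirchhoff_loop : P0 false - P1 false + P0 true = 0.
  have := kirP (fun=> 1) (fun _ _ => erefl).
  by rewrite !mul1r P1t subr0.
pose b := Phi true * amp (k * l) / 2%:R.
have bE : b * (2%:R / amp (k * l)) = Phi true by rewrite /b; field; rewrite a2.
have [Phi2 P0t Ft] : [/\ Phi false = b * cos (ph (k * l)),
    P0 true = k * 2%:R * (b * sin (ph (k * l))) &
    0 < l -> forall x, x \in `[0, l] -> F true x = tadpole_wave k 0 b true x].
  rewrite -amp_cos// mulrA bE.
  rewrite (_ : k * 2%:R * _ = k * (Phi true * sin (k * l))); last first.
    by rewrite -bE -(mulrA b) (@amp_sin R 2)//; ring.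
  have [l0|l0] := ltP 0 l; last first.
    have lE : l = 0 by apply/eqP; rewrite eq_le l0 l_ge0.
    split; [|rewrite /P0/= ltNge l0 lE mulr0 sin0; ring|by []].
    by rewrite lE mulr0 cos0 mulr1; exact: (inv true).
  have s0 : 0 \in `[0, l] by rewrite in_itv/= lexx ltW.
  have s1 : l \in `[0, l] by rewrite in_itv/= lexx ltW.
  have [/= F0 F1] := Fphi true l0.
  have d1 : derive1 (F true) l = 0 by move: P1t; rewrite /P1/= l0.
  have sol x := @solution_on_edge R _ k 0 l l x kn0 (Fs true l0) s1.
  have [e1 e2] := sol _ s0; rewrite /P0/= l0; split.
  - by rewrite -F0 e1 d1 F1 sub0r mulrN cosN; ring.
  - by rewrite e2 d1 F1 sub0r mulrN sinN; ring.
  - by move=> _ x /sol[-> _]; rewrite /tadpole_wave /wave bE d1 F1 mul0r mul0r addr0 mulrBr.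
set be := ph (k * l) in Phi2 P0t *.
have [h0|h0] := ltP 0 h; last first.
  have h_0 : h = 0 by apply/eqP; rewrite eq_le h0 h_ge0.
  have loop0 : 0 < tad_len false = false by rewrite /= hE h_0 addr0 ltxx.
  exists (Phi false), b; split.
  - by case=> //; rewrite loop0.
  - by rewrite h_0 mulr0 cos0 mulr1.
  - rewrite h_0 mulr0 sin0 mulr0.
    move: kirchhoff_loop; rewrite {1}/P0 /P1 loop0 subrr add0r P0t => /eqP.
    by rewrite mulf_eq0 mulf_eq0 (negbTE kn0)/= pnatr_eq0/= => /eqP ->; rewrite oppr0.
have loop0 : 0 < tad_len false by rewrite /= hE addr_gt0.
have hh : h \in `[0, L - l] by rewrite in_itv/= hE ltW//= lerDl.
have s0 : 0 \in `[0, L - l] by rewrite in_itv/= lexx hE addr_ge0.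
have s1 : L - l \in `[0, L - l] by rewrite in_itv/= lexx hE addr_ge0.
have skh : sin (k * h) != 0 by rewrite lt0r_neq0// sin_gt0_pi// mulr_gt0.
have sol x := @solution_on_edge R _ k 0 (L - l) h x kn0 (Fs false loop0) hh.
have [/= F0 F1] := Fphi false loop0.
have [e0 d0] := sol _ s0; have [e1 d1] := sol _ s1.
have hB : L - l - h = h by rewrite hE addrK.
rewrite sub0r mulrN sinN cosN in e0 d0; rewrite hB in e1 d1.
(* Seen from the midpoint, the two ends of the loop differ only in the sign of the sine term; they
   have equal values, so the slope at the midpoint vanishes and the wave is even about it. *)
have dh : derive1 (F false) h = 0.
  have : derive1 (F false) h / k * sin (k * h) = 0 by move: e0 e1; rewrite F0 F1; lra.
  by move=> /eqP; rewrite !mulf_eq0 (negbTE skh) invr_eq0 (negbTE kn0) !orbF => /eqP.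
exists (F false h), b; split.
- by case=> le x xe; [exact: Ft|have [-> _] := sol _ xe; rewrite dh !mul0r addr0 mulrBr].
- by rewrite -Phi2 -F0 e0 dh; ring.
- move: kirchhoff_loop; rewrite P0t /P0 /P1 loop0 d0 /= d1 dh !mul0r !addr0 => e.
  apply: (mulfI (lt0r_neq0 (mulr_gt0 k0 two_gt0))); lra.
Qed.

Lemma tadpole_wave_eigenspace k : resonant L 0 2%:R l k ->
  exists Phi, contracted_eigenspace tad_src tad_tgt tad_len
    (k ^+ 2) (tadpole_wave k 1 (- 1)) Phi.
Proof.
move=> r; have := @resonant_mid R L 0 2 l k r; rewrite mulr0 phase0 addr0 -/h => mid.
have [k0 _] := r.
pose Phi (v : bool) : R := if v then - (2%:R / amp (k * l)) else cos (k * h).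
have chm : cos (k * h) = - cos (ph (k * l)).
  by rewrite mid cosB cospi sinpi; ring.
have shm : sin (k * h) = sin (ph (k * l)).
  by rewrite mid sinB cospi sinpi; ring.
exists Phi; split.
- by case=> _ x _; exact: wave_solves.
- case=> _; rewrite /= /wave /Phi/=.
  + rewrite mulr0 add0r cosN subrr cos0 chm -amp_cos//; split; ring.
  + rewrite mulr0 add0r cosN hE mulrDr addrK; split; ring.
- case=> //= h0; rewrite /Phi/= chm.
  have -> : l = 0 by apply/eqP; rewrite eq_le h0 l_ge0.
  by rewrite mulr0 -amp_cos// cos0 mulr1.
- move=> Psi inv; rewrite big_mkcond big_bool /= /tadpole_wave !derive1_wave.
  set A := (if 0 < l then _ else 0).
  have -> : A = - (Psi false * (k * 2%:R * sin (ph (k * l)))).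
    rewrite /A; case: ifPn => [_|]; last first.
      rewrite -leNgt => h0; have -> : l = 0 by apply/eqP; rewrite eq_le h0 l_ge0.
      by rewrite mulr0 phase0 sin0 !mulr0 oppr0.
    by rewrite -(mulrA k) -(@amp_sin R 2)// mulr0 add0r subrr sin0 sinN; ring.
  case: ifPn => [_|].
    have -> : k * (L - l) - k * h = k * h by rewrite hE; ring.
    by rewrite mulr0 add0r sinN shm; ring.
  rewrite -leNgt hE => h0; have h_0 : h = 0 by have := h_ge0; lra.
  by rewrite -shm h_0 mulr0 sin0; ring.
Qed.

Lemma lambda2_tadpoleE k : resonant L 0 2%:R l k -> lambdaN (tadpole L l) 2 = k ^+ 2.
Proof.
move=> r; have [k0 kE] := r.
have [Phi /eigenspace_restrict Ew] := tadpole_wave_eigenspace r.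
have cos_lt1 u : 0 < u -> u <= pi -> cos u < 1.
  move=> u0 upi; rewrite -cos0 ltr_cos// in_itv/= ?lexx ?pi_ge0//.
  by rewrite ltW.
have [khpi klpi] : k * h <= pi /\ k * l <= pi.
  have [_ _ p2 _ klpi] := resonant_phase_le two_gt0 T r; split=> //.
  by move: kE; rewrite /phase_sum -/h mulr0 phase0; lra.
have [[e x] [[e' x'] [xe [xe' /= we]]]] : exists p p' : edge (tadpole L l) * R,
    p.2 \in on_edge p.1 /\ p'.2 \in on_edge p'.1 /\
    tadpole_wave k 1 (- 1) (val p.1) p.2 != tadpole_wave k 1 (- 1) (val p'.1) p'.2.
  (* Both ends of the loop have the same value, so nonconstancy is read off between an end and the
     midpoint. *)
  have [h0|h0] := ltP 0 h.
    have loop0 : 0 < tad_len false by rewrite /= hE addr_gt0.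
    pose e : edge (tadpole L l) := exist _ false loop0.
    exists (e, 0), (e, h); split; first exact: on_edge0.
    split; first by rewrite in_itv/= hE ltW//= lerDl.
    rewrite /= /wave mulr0 add0r subrr cos0 cosN !mul1r lt_eqF// cos_lt1//.
    by rewrite mulr_gt0.
  have h_0 : h = 0 by have := h_ge0; lra.
  have lt0 : 0 < l by have := L_gt0; have := hE; rewrite h_0; lra.
  pose e : edge (tadpole L l) := exist _ true lt0.
  exists (e, l), (e, 0); split; first exact: (on_edge_len e).
  split; first exact: on_edge0.
  rewrite /= /wave mulr0 add0r subrr cos0 cosN lt_eqF//.
  rewrite !mulN1r mulNr mulNr ltrN2 ltr_pM2l ?divr_gt0 ?amplitude_gt0//.
  by rewrite cos_lt1// mulr_gt0.
apply: (lambda2_eq tadpole_connected _ Ew xe xe' we); first by rewrite exprn_gt0.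
move=> nu g nu0 nuk; rewrite -[nu]sqr_sqrtr ?(ltW nu0)//.
move=> /eigenspace_extend[Psi Eg] d y yd.
rewrite -(extend_contractionE g).
set j := Num.sqrt nu in Eg.
have j0 : 0 < j by rewrite sqrtr_gt0.
have jpi : phase_sum L 0 2%:R l j < pi.
  rewrite -kE phase_sum_lt// -(ltr_pXn2r (_ : 0 < 2)%N)//.
  + by rewrite sqr_sqrtr// ltW.
  + by rewrite nnegrE ltW.
  + by rewrite nnegrE ltW.
have p0 : 0 < phase_sum L 0 2%:R l j.
  have := @phase_sum_lt R L 0 2%:R l 0 j L_gt0 two_gt0 T.
  by rewrite phase_sum0 j0.
move: jpi p0; rewrite /phase_sum -/h mulr0 phase0 addr0 => jpi p0.
have p2 : 0 <= ph (j * l) by rewrite phase_ge0// mulr_ge0// ltW.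
have [|a [b [FE c s]]] := tadpole_eigenfunction j0 _ Eg; first lra.
have [|a0 b0] := matching_eq0 _ c s; first by apply/andP; split.
rewrite FE//; last exact: (len_gt0 d).
by rewrite a0 b0; case: (val d); rewrite /= /wave !mul0r.
Qed.

End Tadpole.

(** * Continuity in the lengths of the sticks *)

Section Continuity.
Context {R : realType}.
Variables (L : R) (m : nat).
Hypotheses (L_gt0 : 0 < L) (m_gt1 : (2 <= m)%N).

(** At [kf p - eps] the phase sum is below [pi], at [kf p + eps] above. Both strict inequalities
    persist for nearby lengths, and monotonicity in the frequency traps the root between. *)
Lemma continuous_lambda2_ps :
  {within triangle L, continuous (fun p : R * R => lambda2_ps L p.1 m p.2)}.
Proof.
have M1 : 1 < m%:R :> R by rewrite ltr1n.
have M0 := lt_trans ltr01 M1.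
have /choice[kf kfP] (p : R * R) :
    exists k, triangle L p -> resonant L p.1 m%:R p.2 k.
  have [Tp|nTp] := pselect (triangle L p); last by exists 0.
  by case: p Tp => l1 l2 /(exists_resonant L_gt0 M1)[k]; exists k.
have fE p : triangle L p -> lambda2_ps L p.1 m p.2 = kf p ^+ 2.
  by case: p => l1 l2 Tp; exact: (lambda2_psE L_gt0 m_gt1 Tp (kfP _ Tp)).
have slice c : continuous (fun p : R * R => phase_sum L p.1 m%:R p.2 c).
  move=> p; have cp : (fun q : R * R => (q, c)) @ p --> (p, c).
    exact: cvg_pair cvg_id (cvg_cst c).
  exact: (cvg_comp _ _ cp (@continuous_phase_sum R L m%:R M0 (p, c))).
apply/subspace_continuousP => p Tp.
have ckf : kf @ within (triangle L) (nbhs p) --> kf p.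
  apply/cvgrPdist_lt => eps eps0; rewrite near_withinE.
  have Tp' : triangle L (p.1, p.2) by case: (p) Tp.
  have lo : phase_sum L p.1 m%:R p.2 (kf p - eps) < pi.
    by rewrite -(kfP p Tp).2 phase_sum_lt// gtrBl.
  have hi : pi < phase_sum L p.1 m%:R p.2 (kf p + eps).
    by rewrite -(kfP p Tp).2 phase_sum_lt// ltrDl.
  have nlo := cvgr_lt _ (slice _ p) _ lo.
  have nhi := cvgr_gt _ (slice _ p) _ hi.
  near=> q => Tq; have Tq' : triangle L (q.1, q.2) by case: (q) Tq.
  rewrite ltr_distlC; apply/andP; split.
    rewrite -(phase_sum_lt _ _ L_gt0 M0 Tq') (kfP q Tq).2; near: q; exact: nlo.
  rewrite -(phase_sum_lt _ _ L_gt0 M0 Tq') (kfP q Tq).2; near: q; exact: nhi.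
suff h : (fun q : R * R => lambda2_ps L q.1 m q.2) @ within (triangle L) (nbhs p) -->
    kf p ^+ 2 by rewrite -(fE p Tp) in h; exact: h.
apply: (@cvg_trans _ ((fun q => kf q ^+ 2) @ within (triangle L) (nbhs p))).
  apply: near_eq_cvg; rewrite near_withinE; near=> q => Tq.
  by rewrite /= fE.
exact: (cvgM ckf ckf).
Unshelve. all: by end_near. Qed.

End Continuity.

(** * From frequencies to eigenvalues *)

Theorem proposition5p7 (R : realType) (L : R) (L_gt0 : 0 < L) :
  (* simplicity and monotonicity, unless the graph is a pumpkin *)
  (forall (m : nat) (l1 l2 : R), (2 <= m)%N -> triangle L (l1, l2) ->
     l1 + l2 != 0 ->
     simple_eigenvalue (pumpkin_stick L l1 m l2) (lambda2_ps L l1 m l2) /\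
     (forall f : graph_fun (pumpkin_stick L l1 m l2),
        laplacian_eigenspace (lambda2_ps L l1 m l2) f -> edgewise_monotonic f)) /\
  (* continuity on the closed triangle *)
  (forall m : nat, (2 <= m)%N ->
     {within triangle L,
       continuous (fun p : R * R => lambda2_ps L p.1 m p.2)}) /\
  (* (1) *)
  (forall (m : nat) (l1 l2 l1' l2' : R), (2 <= m)%N ->
     triangle L (l1, l2) -> triangle L (l1', l2') ->
     l1 <= l1' -> l2 <= l2' -> (l1 < l1') || (l2 < l2') ->
     lambda2_ps L l1' m l2' < lambda2_ps L l1 m l2) /\
  (* (2); for l1 + l2 = L the graph is the same path for every m *)
  (forall (l1 l2 : R) (m m' : nat), triangle L (l1, l2) -> l1 + l2 < L ->
     (2 <= m)%N -> (m < m')%N ->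
     lambda2_ps L l1 m l2 < lambda2_ps L l1 m' l2) /\
  (* (3); for l = L the graph is the same path for every l1 *)
  (forall (m : nat) (l l1 l1' : R), (2 <= m)%N -> 0 <= l -> l < L ->
     0 <= l1 -> l1 < l1' -> l1' <= l / 2 ->
     lambda2_ps L l1 m (l - l1) < lambda2_ps L l1' m (l - l1')) /\
  (* (4) *)
  (forall (m : nat) (l l1 : R), (2 <= m)%N -> 0 <= l -> l <= L ->
     0 <= l1 -> l1 <= l ->
     lambda2_ps L 0 m l <= lambda2_ps L l1 m (l - l1) /\
     lambda2_ps L 0 2 l <= lambda2_ps L l1 m (l - l1)) /\
  (forall l : R, 0 <= l -> l <= L ->
     lambda2_ps L 0 2 l = lambdaN (tadpole L l) 2) /\
  (* the two-sided estimate and its equality cases *)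
  (forall (m : nat) (l1 l2 : R), (2 <= m)%N -> triangle L (l1, l2) ->
     [/\ pi ^+ 2 / L ^+ 2 <= lambda2_ps L l1 m l2,
         lambda2_ps L l1 m l2 <= pi ^+ 2 * m%:R ^+ 2 / L ^+ 2,
         lambda2_ps L l1 m l2 = pi ^+ 2 / L ^+ 2 <-> l1 + l2 = L
       & lambda2_ps L l1 m l2 = pi ^+ 2 * m%:R ^+ 2 / L ^+ 2
           <-> l1 + l2 = 0]).
Proof.
have M1 (m : nat) : (2 <= m)%N -> 1 < m%:R :> R by rewrite ltr1n.
have M0 (m : nat) : (2 <= m)%N -> 0 < m%:R :> R by move=> /M1; exact: lt_trans.
have ex (m : nat) (l1 l2 : R) : (2 <= m)%N -> triangle L (l1, l2) ->
    exists k, resonant L l1 m%:R l2 k /\ lambda2_ps L l1 m l2 = k ^+ 2.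
  move=> m2 T; have [k r] := exists_resonant L_gt0 (M1 _ m2) T.
  by exists k; split=> //; exact: lambda2_psE.
have sqr_lt (k k' : R) : 0 < k -> 0 < k' -> (k ^+ 2 < k' ^+ 2) = (k < k').
  by move=> k0 k'0; rewrite ltr_pXn2r// nnegrE ltW.
have anti (m : nat) (l1 l2 l1' l2' : R) : (2 <= m)%N ->
    triangle L (l1, l2) -> triangle L (l1', l2') ->
    l1 <= l1' -> l2 <= l2' -> (l1 < l1') || (l2 < l2') ->
    lambda2_ps L l1' m l2' < lambda2_ps L l1 m l2.
  move=> m2 T T' h1 h2 h12; have [k [r ->]] := ex _ _ _ m2 T.
  have [k' [r' ->]] := ex _ _ _ m2 T'.
  rewrite sqr_lt; [|exact: r'.1|exact: r.1].
  exact: (resonant_anti L_gt0 (M1 _ m2) T T' r r').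
have incr_m (l1 l2 : R) (m m' : nat) : triangle L (l1, l2) -> l1 + l2 < L ->
    (2 <= m)%N -> (m < m')%N -> lambda2_ps L l1 m l2 < lambda2_ps L l1 m' l2.
  move=> T lL m2 mm'; have m2' := leq_trans m2 (ltnW mm').
  have [k [r ->]] := ex _ _ _ m2 T; have [k' [r' ->]] := ex _ _ _ m2' T.
  rewrite sqr_lt; [|exact: r.1|exact: r'.1].
  by apply: (resonant_incr_m L_gt0 (M0 _ m2) _ T lL r r'); rewrite ltr_nat.
have incr_shift (m : nat) (l l1 l1' : R) : (2 <= m)%N -> 0 <= l -> l < L ->
    0 <= l1 -> l1 < l1' -> l1' <= l / 2 ->
    lambda2_ps L l1 m (l - l1) < lambda2_ps L l1' m (l - l1').
  move=> m2 l0 lL l10 ll' l'l.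
  have T : triangle L (l1, l - l1) by split=> /=; lra.
  have T' : triangle L (l1', l - l1') by split=> /=; lra.
  have [k [r ->]] := ex _ _ _ m2 T; have [k' [r' ->]] := ex _ _ _ m2 T'.
  rewrite sqr_lt; [|exact: r.1|exact: r'.1].
  exact: (resonant_incr_shift L_gt0 (M1 _ m2) lL l10 ll' l'l r r').
have sym (m : nat) (l1 l2 : R) : (2 <= m)%N -> triangle L (l1, l2) ->
    lambda2_ps L l1 m l2 = lambda2_ps L l2 m l1.
  move=> m2 T; have T' : triangle L (l2, l1) by case: T => /= ? ? ?; split=> /=; lra.
  have [k [r ->]] := ex _ _ _ m2 T; have [k' [r' ->]] := ex _ _ _ m2 T'.
  congr (_ ^+ 2); apply: (resonant_inj L_gt0 (M0 _ m2) T r).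
  by rewrite /resonant phase_sumC.
have path (m : nat) (l1 : R) : (2 <= m)%N -> 0 <= l1 -> l1 <= L ->
    lambda2_ps L l1 m (L - l1) = (pi / L) ^+ 2.
  move=> m2 l10 l1L; have T : triangle L (l1, L - l1) by split=> /=; lra.
  have [k [r ->]] := ex _ _ _ m2 T.
  by rewrite (resonant_path L_gt0 (M1 _ m2) T r).
have min_end (m : nat) (l l1 : R) : (2 <= m)%N -> 0 <= l -> l <= L ->
    0 <= l1 -> l1 <= l -> lambda2_ps L 0 m l <= lambda2_ps L l1 m (l - l1).
  (* For [l = L] both sides are the eigenvalue of the same path; strict growth in [l1] is available
     only for [l < L]. *)
  move=> m2 l0 lL l10 l1l; have [lE|ltL] := eqVneq l L.
    by rewrite lE path ?(le_trans l1l)// -{2}(subr0 L) path// ltW.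
  have lltL : l < L by rewrite lt_neqAle ltL.
  (* Exchanging the two sticks maps [l1] to [l - l1]. *)
  wlog l1h : l1 l10 l1l / l1 <= l / 2.
    move=> wlg; have [|l1h] := leP l1 (l / 2); first exact: wlg.
    rewrite (sym m l1 (l - l1))//; last by split=> /=; lra.
    have := wlg (l - l1); rewrite subKr; apply; lra.
  move: l10; rewrite le_eqVlt => /predU1P[<-|l10]; first by rewrite subr0.
  by have := incr_shift m l 0 l1 m2 l0 lltL (lexx 0) l10 l1h; rewrite subr0 => /ltW.
have min_m (m : nat) (l : R) : (2 <= m)%N -> 0 <= l -> l <= L ->
    lambda2_ps L 0 2 l <= lambda2_ps L 0 m l.
  move=> m2 l0 lL; have [lE|ltL] := eqVneq l L.
    by rewrite lE -{2 4}(subr0 L) !path// ltW.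
  move: m2; rewrite leq_eqVlt => /predU1P[<-//|m2].
  apply/ltW/incr_m => //; first by split=> //=; rewrite add0r.
  by rewrite add0r lt_neqAle ltL.
split; [|split; [|split; [|split; [|split; [|split; [|split]]]]]] => //.
- move=> m l1 l2 m2 T l0; have [k [r ->]] := ex _ _ _ m2 T; split.
    exact: ps_simple.
  by move=> f; exact: ps_monotonic.
- by move=> m m2; exact: continuous_lambda2_ps.
- move=> m l l1 m2 l0 lL l10 l1l; split; first exact: min_end.
  by apply: (le_trans (min_m m l m2 l0 lL)); exact: min_end.
- move=> l l0 lL; have T : triangle L (0, l) by split=> //=; rewrite add0r.
  have [k [r ->]] := ex 2%N _ _ isT T.
  by rewrite (lambda2_tadpoleE L_gt0 l0 lL r).
- move=> m l1 l2 m2 T; have [k [r ->]] := ex _ _ _ m2 T; have k0 := r.1.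
  have [lo loE] := resonant_lowerbound L_gt0 (M1 _ m2) T r.
  have [up upE] := resonant_upperbound L_gt0 (M1 _ m2) T r.
  have a0 : 0 <= pi / L by rewrite divr_ge0 ?pi_ge0 ?ltW.
  have b0 : 0 <= pi * m%:R / L by rewrite divr_ge0 ?mulr_ge0 ?pi_ge0 ?ltW// M0.
  rewrite -exprMn -!expr_div_n; split.
  + by rewrite ler_pXn2r// nnegrE ltW.
  + by rewrite ler_pXn2r// nnegrE ltW.
  + split=> [/eqP|/eqP].
      by rewrite eqrXn2 ?(ltW k0)// eq_sym loE => /eqP.
    by rewrite -loE => /eqP ->.
  + split=> [/eqP|/eqP].
      by rewrite eqrXn2 ?(ltW k0)// upE => /eqP.
    by rewrite -upE => /eqP ->.
Qed.
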